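(* Let $R$ be a Noetherian commutative $\mathbb{F}$-algebra with characteristic morphism $\kappa:A\to R$, and let $\underline{M}=(M,\tau_M)$ be an $A$-motive over $R$. Then $\operatorname{Hom}_{\mathcal{M}_R}(\mathbbm{1},\underline{M})=\ker(\operatorname{id}-\tau_M:M\to M[\mathfrak{j}^{-1}])$, $\operatorname{Ext}^i_{\mathcal{M}_R}(\mathbbm{1},\underline{M})=0$ for all $i\ge2$; that is, $\operatorname{RHom}_{\mathcal{M}_R}(\mathbbm{1},\underline{M})$ is computed by the complex of $A$-modules $[M\xrightarrow{\operatorname{id}-\tau_M}M[\mathfrak{j}^{-1}]]$ placed in degrees $0$ and $1$. Moreover there is a natural surjective $A$-linear morphism $\iota:M[\mathfrak{j}^{-1}]\twoheadrightarrow\operatorname{Ext}^1_{\mathcal{M}_R}(\mathbbm{1},\underline{M})$ with kernel $(\operatorname{id}-\tau_M)(M)$, sending $m$ to the class of the extension $0\to\underline{M}\to\left(M\oplus(A\otimes R),\begin{pmatrix}\tau_M & m\cdot\mathbf{1}\\0&\mathbf{1}\end{pmatrix}\right)\to\mathbbm{1}\to0$.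
   Context: $\mathbb{F}$ is a finite field with $q$ elements; unlabeled tensor products are over $\mathbb{F}$. $C$ is a geometrically irreducible smooth projective curve over $\mathbb{F}$, $\infty$ a closed point, $A=\Gamma(C\setminus\{\infty\},\mathcal{O}_C)$. For a commutative $\mathbb{F}$-algebra $R$ with $\mathbb{F}$-algebra morphism $\kappa:A\to R$, $\mathfrak{j}\subset A\otimes R$ is the ideal generated by $a\otimes1-1\otimes\kappa(a)$, $a\in A$; $M[\mathfrak{j}^{-1}]=\bigcup_n\mathfrak{j}^{-n}M$ where $\mathfrak{j}^{-n}M$ is the set of elements $m$ of $M\otimes_{A\otimes R}\operatorname{Quot}(A\otimes R)$ with $(a\otimes1-1\otimes\kappa(a))^nm\in M$ for all $a\in A\setminus\mathbb{F}$. $\tau$ is the endomorphism $a\otimes r\mapsto a\otimes r^q$ of $A\otimes R$, $\tau^*M=(A\otimes R)\otimes_{\tau,A\otimes R}M$, and $\mathbf{1}:\tau^*(A\otimes R)\to A\otimes R$ is the canonical isomorphism. An $A$-motive over $R$ is $(M,\tau_M)$ with $M$ locally free of finite constant rank over $A\otimes R$ and $\tau_M:(\tau^*M)[\mathfrak{j}^{-1}]\xrightarrow{\sim}M[\mathfrak{j}^{-1}]$ linear; morphisms are $A\otimes R$-linear maps commuting with the $\tau$'s. $\mathcal{M}_R$ is this category, exact in Quillen's sense with exact sequences those exact on underlying modules; $\operatorname{Ext}^i$ are Yoneda extension modules. $\mathbbm{1}=(A\otimes R,\mathbf{1})$. For $m\in M[\mathfrak{j}^{-1}]$, $m\cdot\mathbf{1}$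 denotes the map $\tau^*(A\otimes R)\to M[\mathfrak{j}^{-1}]$, $x\mapsto\mathbf{1}(x)m$. *)

(* Defs.v *)
From HB Require Import structures.
From mathcomp Require Import all_boot all_order all_algebra.
From mathcomp Require Import generic_quotient.
From mathcomp Require Import mathcomp_extra boolp classical_sets.
From mathcomp Require Import pgroup finfield ring.
From Stdlib Require Import Relation_Operators.

Set Implicit Arguments.
Unset Strict Implicit.
Unset Printing Implicit Defensive.

Import GRing.Theory.
Local Open Scope ring_scope.
Local Open Scope classical_set_scope.
Local Open Scope quotient_scope.

(* Commutative rings are [comPzRingType]s, so that the zero ring is allowed.
   A commutative k-algebra B is given by its structure morphism
   {rmorphism k -> B}. *)

Definition restr (k B : comPzRingType) (f : {rmorphism k -> B})
  (V : lmodType B) : Type := V.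

Section Restriction.
Variables (k B : comPzRingType) (f : {rmorphism k -> B}) (V : lmodType B).
Local Notation restr := (restr f V).

HB.instance Definition _ := GRing.Zmodule.copy restr V.

Let scale (c : k) (v : restr) : restr := (f c *: (v : V) : V).

Let scaleA a b v : scale a (scale b v) = scale (a * b) v.
Proof. by rewrite /scale scalerA rmorphM. Qed.
Let scale1 : left_id 1 scale.
Proof. by move=> v; rewrite /scale rmorph1 scale1r. Qed.
Let scaleDr : right_distributive scale +%R.
Proof. by move=> a u v; rewrite /scale scalerDr. Qed.
Let scaleDl v : {morph scale^~ v : a b / a + b}.
Proof. by move=> a b; rewrite /scale rmorphD scalerDl. Qed.

HB.instance Definition _ :=
  GRing.Zmodule_isLmodule.Build k restr scaleA scale1 scaleDr scaleDl.

Lemma restrE (c : k) (v : restr) : c *: v = f c *: (v : V).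
Proof. by []. Qed.
End Restriction.

Section BaseChange.
Variables (k B : comPzRingType) (f : {rmorphism k -> B}) (M : lmodType k).

(* Finite formal sums of symbols b (x) m, modulo the defining relations of
   the tensor product B (x)_{f,k} M. *)
Inductive bc_eq : seq (B * M) -> seq (B * M) -> Prop :=
| bc_refl x : bc_eq x x
| bc_sym x y : bc_eq x y -> bc_eq y x
| bc_trans x y z : bc_eq x y -> bc_eq y z -> bc_eq x z
| bc_cat x x' y y' : bc_eq x x' -> bc_eq y y' -> bc_eq (x ++ y) (x' ++ y')
| bc_swap x y : bc_eq (x ++ y) (y ++ x)
| bc_zero m : bc_eq [:: (0, m)] [::]
| bc_addl b b' m : bc_eq [:: (b + b', m)] [:: (b, m); (b', m)]
| bc_addr b m m' : bc_eq [:: (b, m + m')] [:: (b, m); (b, m')]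
| bc_bal b c m : bc_eq [:: (b * f c, m)] [:: (b, c *: m)].

Definition bc_rel : rel (seq (B * M)) := fun x y => `[< bc_eq x y >].

Let bc_rel_refl : reflexive bc_rel.
Proof. by move=> x; apply/asboolP; constructor. Qed.
Let bc_rel_sym : symmetric bc_rel.
Proof.
by move=> x y; apply: asbool_equiv_eq; split; apply: bc_sym.
Qed.
Let bc_rel_trans : transitive bc_rel.
Proof.
move=> y x z /asboolP xy /asboolP yz; apply/asboolP.
exact: bc_trans xy yz.
Qed.

Canonical bc_equiv := EquivRel bc_rel bc_rel_refl bc_rel_sym bc_rel_trans.

Definition bc : Type := {eq_quot bc_equiv}.
HB.instance Definition _ := EqQuotient.on bc.
HB.instance Definition _ := Choice.on bc.

Definition bc_sum (x : seq (B * M)) : bc := \pi_bc x.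

Lemma bc_sumE x y : bc_sum x = bc_sum y <-> bc_eq x y.
Proof.
rewrite /bc_sum; split=> [/eqP|xy].
  by rewrite -[_ == _]/(\pi_{eq_quot bc_equiv} x == \pi_{eq_quot bc_equiv} y) eqmodE => /asboolP.
apply/eqP; rewrite -[_ == _]/(\pi_{eq_quot bc_equiv} x == \pi_{eq_quot bc_equiv} y) eqmodE.
exact/asboolP.
Qed.

Lemma bc_reprK (x : bc) : bc_sum (repr x) = x.
Proof. by rewrite /bc_sum reprK. Qed.

Definition bc_tens b m : bc := bc_sum [:: (b, m)].

Let zero : bc := bc_sum [::].
Let add (x y : bc) : bc := bc_sum (repr x ++ repr y).
Let scale_seq b (x : seq (B * M)) := [seq (b * p.1, p.2) | p <- x].
Let scale b (x : bc) : bc := bc_sum (scale_seq b (repr x)).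

Let addE x y : add (bc_sum x) (bc_sum y) = bc_sum (x ++ y).
Proof. by apply/bc_sumE; apply: bc_cat; apply/bc_sumE; rewrite bc_reprK. Qed.

Let scale_seq_eq b x y : bc_eq x y -> bc_eq (scale_seq b x) (scale_seq b y).
Proof.
rewrite /scale_seq; elim=> //=.
- by move=> *; apply: bc_refl.
- by move=> *; apply: bc_sym.
- by move=> x1 y1 z1 _ h1 _ h2; apply: bc_trans h1 h2.
- by move=> *; rewrite !map_cat; apply: bc_cat.
- by move=> *; rewrite !map_cat; apply: bc_swap.
- by move=> m; rewrite mulr0; apply: bc_zero.
- by move=> *; rewrite mulrDr; apply: bc_addl.
- by move=> *; apply: bc_addr.
- by move=> *; rewrite mulrA; apply: bc_bal.
Qed.

Let scaleE b x : scale b (bc_sum x) = bc_sum (scale_seq b x).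
Proof. by apply/bc_sumE/scale_seq_eq/bc_sumE; rewrite bc_reprK. Qed.

Let addA : associative add.
Proof.
move=> x y z; rewrite -(bc_reprK x) -(bc_reprK y) -(bc_reprK z) !addE.
by rewrite catA.
Qed.
Let addC : commutative add.
Proof.
move=> x y; rewrite -(bc_reprK x) -(bc_reprK y) !addE.
by apply/bc_sumE/bc_swap.
Qed.
Let add0 : left_id zero add.
Proof. by move=> x; rewrite -(bc_reprK x) addE. Qed.
Let addN : left_inverse zero (scale (-1)) add.
Proof.
move=> x; rewrite -(bc_reprK x) scaleE addE; apply/bc_sumE.
elim: (repr x) => [|[b m] s IH] /=; first exact: bc_refl.
have h1 : bc_eq [:: (-1 * b, m); (b, m)] [::].
  apply: bc_trans (bc_zero m); apply: bc_sym.
  by rewrite -[X in (X, m)](addNr b) mulN1r; apply: bc_addl.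
rewrite -cat1s; apply: bc_trans.
  exact: (bc_cat (bc_refl _) (@bc_swap (scale_seq (-1) s) ((b, m) :: s))).
rewrite -[_ ++ _]/([:: (-1 * b, m); (b, m)] ++ (s ++ scale_seq (-1) s)).
rewrite -[[::]]/([::] ++ [::]); apply: bc_cat => //.
exact: bc_trans (bc_swap _ _) IH.
Qed.

HB.instance Definition _ := GRing.isZmodule.Build bc addA addC add0 addN.

Let scaleA a b v : scale a (scale b v) = scale (a * b) v.
Proof.
rewrite -(bc_reprK v) !scaleE; congr bc_sum; rewrite /scale_seq -map_comp.
by apply: eq_map => p /=; rewrite mulrA.
Qed.
Let scale1 : left_id 1 scale.
Proof.
move=> v; rewrite -(bc_reprK v) scaleE; congr bc_sum; rewrite /scale_seq.
by rewrite -[RHS]map_id; apply: eq_map => -[b m] /=; rewrite mul1r.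
Qed.
Let scaleDr : right_distributive scale +%R.
Proof.
move=> a u v; rewrite -(bc_reprK u) -(bc_reprK v).
rewrite -[LHS]/(scale a (add _ _)) -[RHS]/(add _ _) addE !scaleE addE.
by rewrite /scale_seq map_cat.
Qed.
Let scaleDl v : {morph scale^~ v : a b / a + b}.
Proof.
move=> a b; rewrite -(bc_reprK v) !scaleE -[RHS]/(add _ _) addE; apply/bc_sumE.
elim: (repr v) => [|[c m] s IH] /=; first exact: bc_refl.
rewrite mulrDl.
apply: bc_trans.
  by rewrite -cat1s; apply: (bc_cat (bc_addl _ _ _) IH).
rewrite -[_ ++ _]/([:: (a * c, m)] ++ (([:: (b * c, m)] ++ scale_seq a s) ++ scale_seq b s)).
rewrite -[X in bc_eq _ X]/([:: (a * c, m)] ++ (scale_seq a s ++ ([:: (b * c, m)] ++ scale_seq b s))).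
apply: bc_cat; first exact: bc_refl.
by rewrite catA; apply: bc_cat; [apply: bc_swap|apply: bc_refl].
Qed.

HB.instance Definition _ :=
  GRing.Zmodule_isLmodule.Build B bc scaleA scale1 scaleDr scaleDl.

Lemma bc_sum_nil : bc_sum [::] = 0. Proof. by []. Qed.
Lemma bc_sum_cons b m s : bc_sum ((b, m) :: s) = bc_tens b m + bc_sum s.
Proof. by rewrite -[RHS]/(add _ _) addE. Qed.

Lemma bc_ind (P : bc -> Prop) :
  P 0 -> (forall b m, P (bc_tens b m)) ->
  (forall x y, P x -> P y -> P (x + y)) -> forall x, P x.
Proof.
move=> P0 Pt PD x; rewrite -(bc_reprK x).
elim: (repr x) => [|[b m] s IH]; first by rewrite bc_sum_nil.
by rewrite bc_sum_cons; apply: PD.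
Qed.

Lemma bc_tensDl b b' m : bc_tens (b + b') m = bc_tens b m + bc_tens b' m.
Proof. by rewrite -[RHS]/(add _ _) addE; apply/bc_sumE/bc_addl. Qed.
Lemma bc_tensDr b m m' : bc_tens b (m + m') = bc_tens b m + bc_tens b m'.
Proof. by rewrite -[RHS]/(add _ _) addE; apply/bc_sumE/bc_addr. Qed.
Lemma bc_tens_bal b c m : bc_tens (b * f c) m = bc_tens b (c *: m).
Proof. by apply/bc_sumE/bc_bal. Qed.
Lemma bc_tensZ a b m : a *: bc_tens b m = bc_tens (a * b) m.
Proof. by rewrite -[LHS]/(scale a _) scaleE. Qed.

Section Lift.
Variables (W : zmodType) (g : B -> M -> W).
Hypotheses (gDl : forall m, {morph g^~ m : b b' / b + b'})
  (gDr : forall b, {morph g b : m m' / m + m'})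
  (g_bal : forall b c m, g (b * f c) m = g b (c *: m)).

Definition bc_lift (x : bc) : W := \sum_(p <- repr x) g p.1 p.2.

Lemma bc_lift_sum s : bc_lift (bc_sum s) = \sum_(p <- s) g p.1 p.2.
Proof.
have H x y : bc_eq x y -> \sum_(p <- x) g p.1 p.2 = \sum_(p <- y) g p.1 p.2.
  elim=> //=.
  - by move=> x1 y1 z1 _ -> _ ->.
  - by move=> x1 x1' y1 y1' _ h1 _ h2; rewrite !big_cat /= h1 h2.
  - by move=> x1 y1; rewrite !big_cat /= addrC.
  - move=> m; rewrite big_cons !big_nil addr0 /=.
    by apply: (addIr (g 0 m)); rewrite add0r -gDl addr0.
  - by move=> b b' m; rewrite !big_cons !big_nil !addr0 /= gDl.
  - by move=> b m m'; rewrite !big_cons !big_nil !addr0 /= gDr.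
  - by move=> b c m; rewrite !big_cons !big_nil !addr0 /= g_bal.
by apply: H; apply/bc_sumE; rewrite bc_reprK.
Qed.

Lemma bc_lift_tens b m : bc_lift (bc_tens b m) = g b m.
Proof. by rewrite bc_lift_sum big_cons big_nil addr0. Qed.

Lemma bc_liftD : {morph bc_lift : x y / x + y}.
Proof.
move=> x y; rewrite -{1}(bc_reprK x) -{1}(bc_reprK y).
by rewrite -[X in bc_lift X]/(add _ _) addE bc_lift_sum big_cat.
Qed.

Lemma bc_lift0 : bc_lift 0 = 0.
Proof. by rewrite -bc_sum_nil bc_lift_sum big_nil. Qed.
End Lift.

Definition bc_in (m : M) : restr f bc := bc_tens 1 m.
Lemma bc_in_is_linear : linear bc_in.
Proof.
move=> c m m'; rewrite /bc_in bc_tensDr; congr (_ + _).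
by rewrite restrE -bc_tens_bal mul1r bc_tensZ mulr1.
Qed.
HB.instance Definition _ :=
  GRing.isLinear.Build k M (restr f bc) _ bc_in bc_in_is_linear.
End BaseChange.

Lemma bc_ext (k B : comPzRingType) (f : {rmorphism k -> B}) (M : lmodType k)
    (W : nmodType) (u v : bc f M -> W) :
  {morph u : x y / x + y} -> {morph v : x y / x + y} -> u 0 = v 0 ->
  (forall b m, u (bc_tens f b m) = v (bc_tens f b m)) -> u =1 v.
Proof.
move=> uD vD e0 e; apply: bc_ind => // x y hx hy.
by rewrite uD vD hx hy.
Qed.

Section BaseChangeMap.
Variables (k B : comPzRingType) (f : {rmorphism k -> B}) (M N : lmodType k).

Definition bc_map (g : {linear M -> N}) : bc f M -> bc f N :=
  bc_lift (fun b m => bc_tens f b (g m)).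

Variable g : {linear M -> N}.

Lemma bc_map_tens b m : bc_map g (bc_tens f b m) = bc_tens f b (g m).
Proof.
rewrite /bc_map bc_lift_tens //= => *.
- by move=> ? ?; rewrite bc_tensDl.
- by move=> ? ?; rewrite linearD bc_tensDr.
- by rewrite linearZ bc_tens_bal.
Qed.

Lemma bc_map_is_linear : linear (bc_map g).
Proof.
have gD : {morph bc_map g : x y / x + y}.
  apply: bc_liftD => * //=.
  - by move=> ? ?; rewrite bc_tensDl.
  - by move=> ? ?; rewrite linearD bc_tensDr.
  - by rewrite linearZ bc_tens_bal.
have g0 : bc_map g 0 = 0.
  by apply: (addIr (bc_map g 0)); rewrite add0r -gD addr0.
move=> a x y; rewrite gD; congr (_ + _).
elim/bc_ind: x => [|b m|x x' hx hx'].
- by rewrite g0 !scaler0 g0.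
- by rewrite bc_tensZ !bc_map_tens bc_tensZ.
- by rewrite scalerDr !gD scalerDr hx hx'.
Qed.
HB.instance Definition _ :=
  GRing.isLinear.Build B (bc f M) (bc f N) _ (bc_map g) bc_map_is_linear.
End BaseChangeMap.
Arguments bc_map {k B} f {M N} g x.

Section BaseChangeUnit.
Variables (k B : comPzRingType) (f : {rmorphism k -> B}).

(* The canonical isomorphism B (x)_{f,k} k -> B. *)
Definition bc_unit : bc f k^o -> B^o := bc_lift (fun b (c : k^o) => b * f c : B^o).

Lemma bc_unit_tens b c : bc_unit (bc_tens f b c) = b * f c.
Proof.
rewrite /bc_unit bc_lift_tens //= => *.
- by move=> ? ?; rewrite mulrDl.
- by move=> ? ?; rewrite rmorphD mulrDr.
- by rewrite -mulrA -rmorphM.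
Qed.

Lemma bc_unit_is_linear : linear bc_unit.
Proof.
have gD : {morph bc_unit : x y / x + y}.
  apply: bc_liftD => * //=.
  - by move=> ? ?; rewrite mulrDl.
  - by move=> ? ?; rewrite rmorphD mulrDr.
  - by rewrite -mulrA -rmorphM.
have g0 : bc_unit 0 = 0.
  by apply: (addIr (bc_unit 0)); rewrite add0r -gD addr0.
move=> a x y; rewrite gD; congr (_ + _).
elim/bc_ind: x => [|b m|x x' hx hx'].
- by rewrite g0 !scaler0 g0.
- by rewrite bc_tensZ !bc_unit_tens [RHS]mulrA.
- by rewrite scalerDr !gD scalerDr hx hx'.
Qed.
HB.instance Definition _ :=
  GRing.isLinear.Build B (bc f k^o) B^o _ bc_unit bc_unit_is_linear.

Lemma bc_unit_bij : bijective bc_unit.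
Proof.
exists (fun b : B^o => bc_tens f b (1 : k^o)) => x; last first.
  by rewrite bc_unit_tens rmorph1 mulr1.
elim/bc_ind: x => [|b m|x x' hx hx'].
- rewrite raddf0; apply: (addIr (bc_tens f 0 (1 : k^o))).
  by rewrite add0r -bc_tensDl addr0.
- by rewrite bc_unit_tens bc_tens_bal; congr bc_tens; rewrite -[LHS]/(m * 1) mulr1.
- by rewrite raddfD bc_tensDl hx hx'.
Qed.
End BaseChangeUnit.
Arguments bc_unit {k B} f x.

Record mulset (S : comPzRingType) := MulSet {
  mulset_set :> S -> Prop;
  mulset1 : mulset_set 1;
  mulsetM : forall s t, mulset_set s -> mulset_set t -> mulset_set (s * t) }.

Section Localisation.
Variables (S : comPzRingType) (U : mulset S).

Definition denom : Type := {t : S | `[< U t >]}.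
HB.instance Definition _ := Choice.on denom.

Definition dval (t : denom) : S := val t.
Definition mk_denom t (Ut : U t) : denom := exist _ t (asboolT Ut).
Lemma mk_denomE t (Ut : U t) : dval (mk_denom Ut) = t. Proof. by []. Qed.
Lemma denomP (t : denom) : U (dval t). Proof. exact/asboolP/(valP t). Qed.

Definition loc_rel : rel (S * denom) := fun p q =>
  `[< exists u, U u /\ u * (p.1 * dval q.2) = u * (q.1 * dval p.2) >].

Let loc_rel_refl : reflexive loc_rel.
Proof. by move=> x; apply/asboolP; exists 1; split; first exact: mulset1. Qed.
Let loc_rel_sym : symmetric loc_rel.
Proof.
by move=> x y; apply: asbool_equiv_eq; split=> -[u [Uu e]]; exists u.
Qed.
Let loc_rel_trans : transitive loc_rel.
Proof.
move=> [y1 y2] [x1 x2] [z1 z2] /asboolP/= [u [Uu e]] /asboolP/= [v [Uv e']].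
apply/asboolP; exists (u * v * dval y2) => /=; split.
  by do !apply: mulsetM => //; apply: denomP.
transitivity (v * dval z2 * (u * (x1 * dval y2))); first by ring.
rewrite e; transitivity (u * dval x2 * (v * (y1 * dval z2))); first by ring.
by rewrite e'; ring.
Qed.

Canonical loc_equiv := EquivRel loc_rel loc_rel_refl loc_rel_sym loc_rel_trans.

Definition loc : Type := {eq_quot loc_equiv}.
HB.instance Definition _ := EqQuotient.on loc.
HB.instance Definition _ := Choice.on loc.

Definition frac (s : S) (t : denom) : loc := \pi_loc (s, t).

Lemma fracE s t s' t' :
  frac s t = frac s' t' <-> exists u, U u /\ u * (s * dval t') = u * (s' * dval t).
Proof.
rewrite /frac; split=> [/eqP|h].
  rewrite -[_ == _]/(\pi_{eq_quot loc_equiv} (s, t) == \pi_{eq_quot loc_equiv} (s', t')).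
  by rewrite eqmodE => /asboolP.
apply/eqP.
rewrite -[_ == _]/(\pi_{eq_quot loc_equiv} (s, t) == \pi_{eq_quot loc_equiv} (s', t')).
by rewrite eqmodE; apply/asboolP.
Qed.

Lemma frac_ex (x : loc) : exists s t, x = frac s t.
Proof. by exists (repr x).1, (repr x).2; rewrite /frac -surjective_pairing reprK. Qed.

Lemma frac_repr (x : loc) : frac (repr x).1 (repr x).2 = x.
Proof. by rewrite /frac -surjective_pairing reprK. Qed.

Let one_d : denom := mk_denom (mulset1 U).
Let mul_d (t t' : denom) : denom := mk_denom (mulsetM (denomP t) (denomP t')).

Let zero := frac 0 one_d.
Let one := frac 1 one_d.
Let add (x y : loc) :=
  let p := repr x in let q := repr y in
  frac (p.1 * dval q.2 + q.1 * dval p.2) (mul_d p.2 q.2).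
Let opp (x : loc) := frac (- (repr x).1) (repr x).2.
Let mul (x y : loc) :=
  frac ((repr x).1 * (repr y).1) (mul_d (repr x).2 (repr y).2).

Let addE s t s' t' :
  add (frac s t) (frac s' t') = frac (s * dval t' + s' * dval t) (mul_d t t').
Proof.
rewrite /add; set p := repr (frac s t); set q := repr (frac s' t').
have /fracE[u [Uu e]] : frac p.1 p.2 = frac s t by exact: frac_repr.
have /fracE[v [Uv e']] : frac q.1 q.2 = frac s' t' by exact: frac_repr.
apply/fracE; exists (u * v); rewrite ?mk_denomE; split; first exact: mulsetM.
transitivity (v * dval q.2 * dval t' * (u * (p.1 * dval t))
  + u * dval p.2 * dval t * (v * (q.1 * dval t'))); first by ring.
by rewrite e e'; ring.
Qed.
Let oppE s t : opp (frac s t) = frac (- s) t.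
Proof.
rewrite /opp; set p := repr (frac s t).
have /fracE[u [Uu e]] : frac p.1 p.2 = frac s t by exact: frac_repr.
by apply/fracE; exists u; split=> //; rewrite !mulNr !mulrN e.
Qed.
Let mulE s t s' t' : mul (frac s t) (frac s' t') = frac (s * s') (mul_d t t').
Proof.
rewrite /mul; set p := repr (frac s t); set q := repr (frac s' t').
have /fracE[u [Uu e]] : frac p.1 p.2 = frac s t by exact: frac_repr.
have /fracE[v [Uv e']] : frac q.1 q.2 = frac s' t' by exact: frac_repr.
apply/fracE; exists (u * v); rewrite ?mk_denomE; split; first exact: mulsetM.
transitivity (u * (p.1 * dval t) * (v * (q.1 * dval t'))); first by ring.
by rewrite e e'; ring.
Qed.

Let fracP s t s' t' : s * dval t' = s' * dval t -> frac s t = frac s' t'.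
Proof. by move=> e; apply/fracE; exists 1; rewrite e; split; first exact: mulset1. Qed.

Let addA : associative add.
Proof.
move=> x y z; rewrite -(frac_repr x) -(frac_repr y) -(frac_repr z) !addE.
by apply: fracP; rewrite ?mk_denomE; ring.
Qed.
Let addC : commutative add.
Proof.
move=> x y; rewrite -(frac_repr x) -(frac_repr y) !addE.
by apply: fracP; rewrite ?mk_denomE; ring.
Qed.
Let add0 : left_id zero add.
Proof.
by move=> x; rewrite -(frac_repr x) addE; apply: fracP; rewrite ?mk_denomE; ring.
Qed.
Let addN : left_inverse zero opp add.
Proof.
by move=> x; rewrite -(frac_repr x) oppE addE; apply: fracP; rewrite ?mk_denomE; ring.
Qed.
HB.instance Definition _ := GRing.isZmodule.Build loc addA addC add0 addN.

Let mulA : associative mul.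
Proof.
move=> x y z; rewrite -(frac_repr x) -(frac_repr y) -(frac_repr z) !mulE.
by apply: fracP; rewrite ?mk_denomE; ring.
Qed.
Let mulC : commutative mul.
Proof.
move=> x y; rewrite -(frac_repr x) -(frac_repr y) !mulE.
by apply: fracP; rewrite ?mk_denomE; ring.
Qed.
Let mul1 : left_id one mul.
Proof.
by move=> x; rewrite -(frac_repr x) mulE; apply: fracP; rewrite ?mk_denomE; ring.
Qed.
Let mulD : left_distributive mul +%R.
Proof.
move=> x y z; rewrite -(frac_repr x) -(frac_repr y) -(frac_repr z).
rewrite -[LHS]/(mul (add _ _) _) -[RHS]/(add _ _) addE !mulE addE.
by apply: fracP; rewrite ?mk_denomE; ring.
Qed.
HB.instance Definition _ :=
  GRing.Zmodule_isComPzRing.Build loc mulA mulC mul1 mulD.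

Definition loc_in (s : S) : loc := frac s one_d.

Lemma loc_in_zmod : zmod_morphism loc_in.
Proof.
move=> x y; rewrite -[RHS]/(add _ (opp _)) oppE addE.
by apply: fracP; rewrite ?mk_denomE; ring.
Qed.
Lemma loc_in_monoid : monoid_morphism loc_in.
Proof.
split=> // x y; rewrite -[RHS]/(mul _ _) mulE.
by apply: fracP; rewrite ?mk_denomE; ring.
Qed.
HB.instance Definition _ := GRing.isZmodMorphism.Build S loc loc_in loc_in_zmod.
HB.instance Definition _ := GRing.isMonoidMorphism.Build S loc loc_in loc_in_monoid.

Lemma loc_in_unit (t : denom) : frac 1 t * loc_in (dval t) = 1.
Proof. by rewrite -[LHS]/(mul _ _) mulE; apply: fracP; rewrite ?mk_denomE; ring. Qed.

Lemma frac_mul s t : frac s t = loc_in s * frac 1 t.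
Proof. by rewrite -[RHS]/(mul _ _) mulE; apply: fracP; rewrite ?mk_denomE; ring. Qed.

Section LocLift.
Variables (B : comPzRingType) (g : {rmorphism S -> B}).
Hypothesis g_inv : forall t, U t -> exists b, b * g t = 1.

Lemma loc_lift_ex : exists h : {rmorphism loc -> B}, forall s, h (loc_in s) = g s.
Proof.
pose inv (t : denom) : B := sval (cid (g_inv (denomP t))).
have invP t : inv t * g (dval t) = 1 by exact: (svalP (cid (g_inv (denomP t)))).
have cancel t x y : x * g (dval t) = y * g (dval t) -> x = y.
  move=> e; rewrite -[x]mulr1 -[y]mulr1 -(invP t).
  by rewrite [inv t * _]mulrC !mulrA e.
pose h (x : loc) : B := g (repr x).1 * inv (repr x).2.
have hP s t : h (frac s t) * g (dval t) = g s.
  rewrite /h; set p := repr (frac s t).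
  have /fracE[u [Uu e]] : frac p.1 p.2 = frac s t by exact: frac_repr.
  have [b hb] := g_inv Uu.
  apply: (cancel p.2).
  transitivity (b * g u * (g p.1 * g (dval t)) * (inv p.2 * g (dval p.2))).
    by rewrite hb; ring.
  rewrite invP mulr1 -mulrA -!rmorphM e !rmorphM mulrA hb mul1r.
  by [].
have hE s t x : x * g (dval t) = g s -> h (frac s t) = x.
  by move=> e; apply: (cancel t); rewrite hP.
have hZ : zmod_morphism h.
  move=> x y; rewrite -(frac_repr x) -(frac_repr y).
  rewrite -[X in h X]/(add _ (opp _)) oppE addE; apply: hE; rewrite ?mk_denomE.
  rewrite rmorphM mulrBl rmorphD !rmorphM rmorphN mulrA hP.
  rewrite [X in _ - X](_ : _ = h (frac (repr y).1 (repr y).2) * g (dval (repr y).2) * g (dval (repr x).2)); last by ring.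
  by rewrite hP; ring.
have hM : monoid_morphism h.
  split; first by apply: hE; rewrite mk_denomE rmorph1 mul1r.
  move=> x y; rewrite -(frac_repr x) -(frac_repr y).
  rewrite -[X in h X]/(mul _ _) mulE; apply: hE; rewrite ?mk_denomE.
  rewrite rmorphM.
  transitivity (h (frac (repr x).1 (repr x).2) * g (dval (repr x).2)
     * (h (frac (repr y).1 (repr y).2) * g (dval (repr y).2))); first by ring.
  by rewrite !hP rmorphM.
pose hZi := GRing.isZmodMorphism.Build _ _ h hZ.
pose hMi := GRing.isMonoidMorphism.Build _ _ h hM.
pose h' : {rmorphism loc -> B} := HB.pack h hZi hMi.
exists h' => s; apply: (hE s one_d).
by rewrite mk_denomE rmorph1 mulr1.
Qed.
End LocLift.
End Localisation.
Arguments loc_in {S} U s.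

Section Pairing.
Variables (S : comPzRingType) (M N : lmodType S).
Definition inl_mod (m : M) : M * N := (m, 0).
Definition inr_mod (n : N) : M * N := (0, n).
Lemma inl_mod_is_linear : linear inl_mod.
Proof. by move=> a x y; congr pair; rewrite /= scaler0 addr0. Qed.
Lemma inr_mod_is_linear : linear inr_mod.
Proof. by move=> a x y; congr pair; rewrite /= scaler0 addr0. Qed.
HB.instance Definition _ :=
  GRing.isLinear.Build S M (M * N)%type _ inl_mod inl_mod_is_linear.
HB.instance Definition _ :=
  GRing.isLinear.Build S N (M * N)%type _ inr_mod inr_mod_is_linear.
Lemma inlr_mod (x : M * N) : inl_mod x.1 + inr_mod x.2 = x.
Proof. by case: x => m n; congr pair; rewrite /= ?addr0 ?add0r. Qed.
End Pairing.
Arguments inl_mod {S M} N m.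
Arguments inr_mod {S} M {N} n.

Section Powers.
Variables (S : comPzRingType) (f : S).
Definition powers_set : set S := [set t | exists n, t = f ^+ n].
Lemma powers1 : powers_set 1. Proof. by exists 0%N; rewrite expr0. Qed.
Lemma powersM s t : powers_set s -> powers_set t -> powers_set (s * t).
Proof. by move=> [n ->] [m ->]; exists (n + m)%N; rewrite exprD. Qed.
Definition powers : mulset S := MulSet powers1 powersM.
End Powers.

Section Regular.
Variable S : comPzRingType.
Definition regular_set : set S := [set t | forall s, t * s = 0 -> s = 0].
Lemma regular_set1 : regular_set 1. Proof. by move=> s; rewrite mul1r. Qed.
Lemma regular_setM s t :
  regular_set s -> regular_set t -> regular_set (s * t).
Proof. by move=> hs ht u; rewrite -mulrA => /hs/ht. Qed.
Definition regular_elements : mulset S := MulSet regular_set1 regular_setM.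
End Regular.

(* Quot S, the total ring of fractions *)
Definition quot (S : comPzRingType) : comPzRingType := loc (regular_elements S).
Definition to_quot (S : comPzRingType) : {rmorphism S -> quot S} :=
  loc_in (regular_elements S).

(* M is free of rank r on each member of a finite cover of Spec S by
   principal open subsets D(f i). *)
Definition locally_free_rank (S : comPzRingType) (M : lmodType S) (r : nat) :=
  exists (I : finType) (f c : I -> S), \sum_i c i * f i = 1 /\
    forall i, exists phi : {linear bc (loc_in (powers (f i))) M ->
                                   'rV[loc (powers (f i))]_r}, bijective phi.

Definition locally_free (S : comPzRingType) (M : lmodType S) :=
  exists r, locally_free_rank M r.

Section LocallyFreeTheory.

Lemma bc_map_comp (k B : comPzRingType) (f : {rmorphism k -> B})
    (M N P : lmodType k) (g : {linear M -> N}) (h : {linear N -> P})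
    (hg : {linear M -> P}) :
  (forall m, hg m = h (g m)) ->
  forall x, bc_map f hg x = bc_map f h (bc_map f g x).
Proof.
move=> e; apply: bc_ext => [x y|x y||b m]; rewrite ?raddfD ?raddf0 //.
by rewrite !bc_map_tens e.
Qed.

Lemma bc_map_id (k B : comPzRingType) (f : {rmorphism k -> B})
    (M : lmodType k) (g : {linear M -> M}) :
  (forall m, g m = m) -> forall x, bc_map f g x = x.
Proof.
move=> e; apply: bc_ext => [x y|x y||b m]; rewrite ?raddfD ?raddf0 //.
by rewrite !bc_map_tens e.
Qed.

Lemma bc_mapD (k B : comPzRingType) (f : {rmorphism k -> B})
    (M N : lmodType k) (g h gh : {linear M -> N}) :
  (forall m, gh m = g m + h m) ->
  forall x, bc_map f gh x = bc_map f g x + bc_map f h x.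
Proof.
move=> e; apply: bc_ext => [x y|x y||b m].
- by rewrite raddfD.
- by rewrite !raddfD /= addrACA.
- by rewrite !raddf0 addr0.
- by rewrite !bc_map_tens e bc_tensDr.
Qed.

Lemma bc_map0 (k B : comPzRingType) (f : {rmorphism k -> B})
    (M N : lmodType k) (g : {linear M -> N}) :
  (forall m, g m = 0) -> forall x, bc_map f g x = 0.
Proof.
move=> e; have h : forall m, g m = g m + g m by move=> m; rewrite e addr0.
by move=> x; have /eqP := bc_mapD (f := f) h x; rewrite -subr_eq subrr => /eqP.
Qed.

Lemma free_bc (k B B' : comPzRingType) (f : {rmorphism k -> B})
    (f' : {rmorphism k -> B'}) (h : {rmorphism B -> B'})
    (hf : forall s, h (f s) = f' s) (M : lmodType k) r
    (phi : {linear bc f M -> 'rV[B]_r}) (phi_bij : bijective phi) :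
  exists phi' : {linear bc f' M -> 'rV[B']_r}, bijective phi'.
Proof.
have [psi phiK psiK] := phi_bij.
have psiD : {morph psi : x y / x + y}.
  by move=> x y; apply: (can_inj phiK); rewrite linearD !psiK.
have psiZ b x : psi (b *: x) = b *: psi x.
  by apply: (can_inj phiK); rewrite linearZ /= !psiK.
pose g (b : B') (m : M) : 'rV[B']_r := b *: map_mx h (phi (bc_tens f 1 m)).
have gDl m : {morph g^~ m : b b' / b + b'} by move=> b b'; rewrite /g scalerDl.
have gDr b : {morph g b : m m' / m + m'}.
  by move=> m m'; rewrite /g bc_tensDr linearD raddfD scalerDr.
have gbal b c m : g (b * f' c) m = g b (c *: m).
  rewrite /g -scalerA; congr (_ *: _).
  rewrite -bc_tens_bal mul1r -[f c]mulr1 -bc_tensZ linearZ /= -hf.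
  by apply/rowP => j; rewrite !mxE rmorphM.
pose F : bc f' M -> 'rV[B']_r := bc_lift g.
have FT b m : F (bc_tens f' b m) = g b m by rewrite /F bc_lift_tens.
have FD : {morph F : x y / x + y} by apply: bc_liftD.
have F0 : F 0 = 0 by apply: (addIr (F 0)); rewrite add0r -FD addr0.
have Flin : linear F.
  move=> a x y; rewrite FD; congr (_ + _).
  elim/bc_ind: x => [|b m|x x' hx hx'].
  - by rewrite scaler0 F0 scaler0.
  - by rewrite bc_tensZ !FT /g scalerA.
  - by rewrite scalerDr !FD hx hx' scalerDr.
pose u (b : B) (m : M) : bc f' M := bc_tens f' (h b) m.
have uDl m : {morph u^~ m : b b' / b + b'}.
  by move=> b b'; rewrite /u rmorphD bc_tensDl.
have uDr b : {morph u b : m m' / m + m'} by move=> m m'; rewrite /u bc_tensDr.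
have ubal b c m : u (b * f c) m = u b (c *: m).
  by rewrite /u rmorphM hf bc_tens_bal.
pose H : bc f M -> bc f' M := bc_lift u.
have HT b m : H (bc_tens f b m) = bc_tens f' (h b) m by rewrite /H bc_lift_tens.
have HD : {morph H : x y / x + y} by apply: bc_liftD.
have H0 : H 0 = 0 by apply: (addIr (H 0)); rewrite add0r -HD addr0.
have HZ b x : H (b *: x) = h b *: H x.
  elim/bc_ind: x => [|b' m|x x' hx hx'].
  - by rewrite scaler0 H0 scaler0.
  - by rewrite bc_tensZ !HT bc_tensZ rmorphM.
  - by rewrite scalerDr !HD hx hx' scalerDr.
have FH x : F (H x) = map_mx h (phi x).
  elim/bc_ind: x => [|b m|x x' hx hx'].
  - by rewrite H0 F0 linear0 raddf0.
  - rewrite HT FT /g -[in RHS](mulr1 b) -bc_tensZ linearZ /=.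
    by apply/rowP => j; rewrite !mxE rmorphM.
  - by rewrite HD FD hx hx' linearD raddfD.
pose e j : 'rV[B]_r := delta_mx 0 j.
pose G (v : 'rV[B']_r) : bc f' M := \sum_j v 0 j *: H (psi (e j)).
have GD : {morph G : x y / x + y}.
  move=> x y; rewrite /G -big_split; apply: eq_bigr => j _.
  by rewrite mxE scalerDl.
have GZ a x : G (a *: x) = a *: G x.
  by rewrite /G scaler_sumr; apply: eq_bigr => j _; rewrite mxE scalerA.
have Hsum (J : finType) (w : J -> bc f M) : H (\sum_j w j) = \sum_j H (w j).
  by apply: (big_morph H HD H0).
have psisum (J : finType) (w : J -> 'rV[B]_r) :
    psi (\sum_j w j) = \sum_j psi (w j).
  apply: (big_morph psi psiD); apply: (addIr (psi 0)).
  by rewrite add0r -psiD addr0.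
have Fsum (J : finType) (w : J -> bc f' M) : F (\sum_j w j) = \sum_j F (w j).
  by apply: (big_morph F FD F0).
pose FLi := GRing.isLinear.Build B' _ _ _ F Flin.
pose F' : {linear bc f' M -> 'rV[B']_r} := HB.pack F FLi.
exists F'; exists G => [x|v] /=.
- elim/bc_ind: x => [|b m|x x' hx hx'].
  + by rewrite F0; apply: (addIr (G 0)); rewrite add0r -GD addr0.
  + rewrite FT /g GZ -[b in RHS]mulr1 -bc_tensZ; congr (_ *: _).
    transitivity (H (bc_tens f 1 m)); last by rewrite HT rmorph1.
    rewrite -[in RHS](phiK (bc_tens f 1 m)) [in RHS](row_sum_delta (phi _)).
    rewrite psisum Hsum; apply: eq_bigr => j _.
    by rewrite psiZ HZ mxE.
  + by rewrite FD GD hx hx'.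
- rewrite /G Fsum [RHS]row_sum_delta; apply: eq_bigr => j _.
  have FZ a x : F (a *: x) = a *: F x.
    by have := Flin a x 0; rewrite !addr0 F0 addr0.
  by rewrite FZ FH psiK map_delta_mx.
Qed.

Lemma free_regular (k B : comPzRingType) (f : {rmorphism k -> B}) :
  exists phi : {linear bc f k^o -> 'rV[B]_1}, bijective phi.
Proof.
pose F (x : bc f k^o) : 'rV[B]_1 := \row_(j < 1) (bc_unit f x : B).
have Flin : linear F.
  by move=> a x y; apply/rowP => j; rewrite !mxE raddfD /= linearZ.
pose FLi := GRing.isLinear.Build B _ _ _ F Flin.
pose F' : {linear bc f k^o -> 'rV[B]_1} := HB.pack F FLi.
have [g fK gK] := bc_unit_bij f.
exists F'; exists (fun v : 'rV[B]_1 => g (v 0 0)) => [x|v] /=.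
  by rewrite /F mxE fK.
by apply/rowP => j; rewrite !mxE gK (ord1 j).
Qed.

Lemma free_prod (k B : comPzRingType) (f : {rmorphism k -> B})
    (M N : lmodType k) r s (phi : {linear bc f M -> 'rV[B]_r})
    (psi : {linear bc f N -> 'rV[B]_s}) :
  bijective phi -> bijective psi ->
  exists chi : {linear bc f (M * N)%type -> 'rV[B]_(r + s)}, bijective chi.
Proof.
move=> [phi' phiK phi'K] [psi' psiK psi'K].
pose p1 : {linear (M * N)%type -> M} := fst.
pose p2 : {linear (M * N)%type -> N} := snd.
pose F (x : bc f (M * N)%type) : 'rV[B]_(r + s) :=
  row_mx (phi (bc_map f p1 x)) (psi (bc_map f p2 x)).
have Flin : linear F.
  by move=> a x y; rewrite /F !linearP scale_row_mx add_row_mx.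
pose FLi := GRing.isLinear.Build B _ _ _ F Flin.
pose F' : {linear bc f (M * N)%type -> 'rV[B]_(r + s)} := HB.pack F FLi.
pose G (v : 'rV[B]_(r + s)) : bc f (M * N)%type :=
  bc_map f (inl_mod N) (phi' (lsubmx v)) + bc_map f (inr_mod M) (psi' (rsubmx v)).
exists F'; exists G => [x|v] /=.
  rewrite /G /F row_mxKl row_mxKr phiK psiK.
  elim/bc_ind: x => [|b [m n]|x y hx hy].
  - by rewrite !raddf0 addr0.
  - by rewrite !bc_map_tens -bc_tensDr inlr_mod.
  - by rewrite !raddfD /= addrACA hx hy.
rewrite /F /G !raddfD /=.
rewrite -(bc_map_comp (hg := idfun)) // -(bc_map_comp (hg := \0)) //.
rewrite -(bc_map_comp (hg := \0)) // -(bc_map_comp (hg := idfun)) //.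
rewrite !(bc_map_id (g := idfun)) // !(bc_map0 (g := \0)) // !raddf0 addr0 add0r.
by rewrite phi'K psi'K hsubmxK.
Qed.

Lemma powers_lift (S : comPzRingType) (f g : S) :
  exists h : {rmorphism loc (powers f) -> loc (powers (f * g))},
    forall s, h (loc_in (powers f) s) = loc_in (powers (f * g)) s.
Proof.
apply: (loc_lift_ex (g := loc_in (powers (f * g)))) => t [n ->].
have Pn : powers (f * g) ((f * g) ^+ n) by exists n.
exists (frac 1 (mk_denom Pn) * loc_in (powers (f * g)) (g ^+ n)).
rewrite -mulrA -rmorphM.
have -> : g ^+ n * f ^+ n = dval (mk_denom Pn) by rewrite mk_denomE exprMn mulrC.
exact: loc_in_unit.
Qed.

Lemma locally_free_regular (S : comPzRingType) : locally_free (S^o : lmodType S).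
Proof.
exists 1%N, unit, (fun=> 1), (fun=> 1); split=> [|i].
  by rewrite big_const card_unit /= addr0 mul1r.
exact: free_regular.
Qed.

Lemma locally_free_prod (S : comPzRingType) (M N : lmodType S) :
  locally_free M -> locally_free N -> locally_free (M * N)%type.
Proof.
move=> [r [I [f [c [fc hf]]]]] [s [J [g [d [gd hg]]]]].
exists (r + s)%N, (I * J)%type, (fun p => f p.1 * g p.2), (fun p => c p.1 * d p.2).
split=> [|[i j] /=].
  rewrite -(pair_bigA _ (fun i j => (c i * d j) * (f i * g j))) /=.
  rewrite -[RHS](mulr1 1) -{1}fc -gd big_distrl /=; apply: eq_bigr => i _.
  by rewrite big_distrr /=; apply: eq_bigr => j _; rewrite mulrACA.
have [phi bphi] := hf i; have [psi bpsi] := hg j.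
have [h hE] := powers_lift (f i) (g j).
have [phi' bphi'] := free_bc hE bphi.
have [h' h'E] := powers_lift (g j) (f i).
have e : g j * f i = f i * g j by rewrite mulrC.
have [psi' bpsi'] := free_bc h'E bpsi.
rewrite e in psi' bpsi'.
exact: free_prod bphi' bpsi'.
Qed.

Lemma locally_free0 (S : comPzRingType) : locally_free ('rV[S]_0 : lmodType S).
Proof.
exists 0%N, unit, (fun=> 1), (fun=> 1); split=> [|i].
  by rewrite big_const card_unit /= addr0 mul1r.
exists \0; exists (fun=> 0) => [x|v]; last by apply/rowP => -[].
rewrite -[RHS](bc_map_id (g := idfun)) //.
rewrite -(bc_map0 (M := 'rV[S]_0) (N := 'rV[S]_0) (g := idfun) _ x) //.
by move=> m; apply/rowP => -[].
Qed.
End LocallyFreeTheory.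

Section InvertIdeal.
Variables (S : comPzRingType) (D : set S).

(* M (x)_S Quot S, as an S-module *)
Definition quot_mod (M : lmodType S) : lmodType S :=
  restr (to_quot S) (bc (to_quot S) M).
Definition to_quot_mod (M : lmodType S) : {linear M -> quot_mod M} :=
  @bc_in _ _ (to_quot S) M.

Definition pole_le (M : lmodType S) (n : nat) : set (quot_mod M) :=
  [set x | forall d, D d -> exists m : M, d ^+ n *: x = to_quot_mod M m].
Arguments pole_le : clear implicits.

Definition pole_pred (M : lmodType S) : {pred quot_mod M} :=
  fun x => `[< (\bigcup_n pole_le M n) x >].
Arguments pole_pred : clear implicits.

Lemma pole_leP (M : lmodType S) (x : quot_mod M) :
  reflect (exists n, pole_le M n x) (x \in pole_pred M).
Proof.
apply: (iffP (asboolP _)) => [[n _ h]|[n h]]; first by exists n.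
by exists n.
Qed.

Lemma pole_leW (M : lmodType S) (x : quot_mod M) n k :
  pole_le M n x -> pole_le M (k + n) x.
Proof.
move=> h d Dd; have [m e] := h d Dd; exists (d ^+ k *: m).
by rewrite exprD -scalerA e linearZ.
Qed.

Lemma pole_submod (M : lmodType S) : submod_closed (pole_pred M).
Proof.
split=> [|a x y /pole_leP[n hx] /pole_leP[k hy]].
  by apply/pole_leP; exists 0%N => d _; exists 0; rewrite scaler0 linear0.
apply/pole_leP; exists (k + n)%N => d Dd.
have [m e] := pole_leW k hx Dd.
have [m' e'] : exists m', d ^+ (k + n) *: y = to_quot_mod M m'.
  by rewrite addnC; exact: pole_leW n hy d Dd.
exists (a *: m + m'); rewrite scalerDr linearP -e -e'; congr (_ + _).
by rewrite !scalerA mulrC.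
Qed.
HB.instance Definition _ (M : lmodType S) :=
  GRing.isSubmodClosed.Build S (quot_mod M) (pole_pred M) (pole_submod M).

(* M[j^-1], for the ideal j generated by D *)
Record inv_ideal (M : lmodType S) := InvIdeal {
  inv_val : quot_mod M;
  inv_valP : inv_val \in pole_pred M }.
HB.instance Definition _ M := [isSub for @inv_val M].
HB.instance Definition _ M := [Choice of inv_ideal M by <:].
HB.instance Definition _ M := [SubChoice_isSubLmodule of inv_ideal M by <:].
End InvertIdeal.
Arguments pole_le {S} D M n.
Arguments inv_ideal {S} D M.
Arguments pole_pred {S} D M.

Section InvertIdealVal.
Variables (S : comPzRingType) (D : set S) (M : lmodType S).

Lemma inv_inj (x y : inv_ideal D M) : inv_val x = inv_val y -> x = y.
Proof. exact: val_inj. Qed.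

Lemma inv_valD (x y : inv_ideal D M) :
  inv_val (x + y) = inv_val x + inv_val y.
Proof. exact: (raddfD val). Qed.
Lemma inv_valZ a (x : inv_ideal D M) : inv_val (a *: x) = a *: inv_val x.
Proof. by []. Qed.

End InvertIdealVal.

Section InvertIdealMaps.
Variables (S : comPzRingType) (D : set S) (M N : lmodType S).

Lemma inv_in_subproof (m : M) : to_quot_mod M m \in pole_pred D M.
Proof. by apply/pole_leP; exists 0%N => d _; exists m; rewrite expr0 scale1r. Qed.

(* the canonical map M -> M[j^-1] *)
Definition inv_in (m : M) : inv_ideal D M := InvIdeal (inv_in_subproof m).
Lemma inv_in_is_linear : linear inv_in.
Proof.
by move=> a x y; apply: inv_inj; rewrite inv_valD inv_valZ /= linearP.
Qed.
HB.instance Definition _ :=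
  GRing.isLinear.Build S M (inv_ideal D M) _ inv_in inv_in_is_linear.

Variable g : {linear M -> N}.

Lemma inv_map_subproof (x : inv_ideal D M) :
  (bc_map (to_quot S) g (inv_val x) : quot_mod N) \in pole_pred D N.
Proof.
have /pole_leP[n h] := inv_valP x; apply/pole_leP; exists n => d Dd.
have [m e] := h d Dd; exists (g m).
rewrite restrE -[LHS]linearZ /=.
by move: e; rewrite restrE => ->; rewrite /= /bc_in bc_map_tens.
Qed.

(* g[j^-1] *)
Definition inv_map (x : inv_ideal D M) : inv_ideal D N :=
  InvIdeal (inv_map_subproof x).
Lemma inv_map_is_linear : linear inv_map.
Proof.
move=> a x y; apply: inv_inj; rewrite inv_valD inv_valZ.
rewrite -[LHS]/(bc_map (to_quot S) g (inv_val (a *: x + y))) inv_valD inv_valZ.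
exact: (linearP (bc_map (to_quot S) g)).
Qed.
HB.instance Definition _ :=
  GRing.isLinear.Build S (inv_ideal D M) (inv_ideal D N) _
    inv_map inv_map_is_linear.
End InvertIdealMaps.
Arguments inv_in {S} D {M} m.
Arguments inv_map {S} D {M N} g x.

Section InvertIdealProduct.
Variables (S : comPzRingType) (D : set S) (M : lmodType S).

(* For s in S[j^-1] and m in M[j^-1], the product s m in M[j^-1]. *)
Lemma inv_mul_subproof (s : inv_ideal D S^o) (m : inv_ideal D M) :
  ((bc_unit (to_quot S) (inv_val s) : quot S) *: (inv_val m : bc (to_quot S) M)
     : quot_mod M) \in pole_pred D M.
Proof.
have /pole_leP[n hs] := inv_valP s; have /pole_leP[k hm] := inv_valP m.
apply/pole_leP; exists (n + k)%N => d Dd.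
have [t e] := hs d Dd; have [m' e'] := hm d Dd.
exists ((t : S) *: m').
rewrite linearZ -e' !restrE /= !scalerA; congr (_ *: _).
have {e} e : to_quot S (d ^+ n) * (bc_unit (to_quot S) (inv_val s) : quot S) = to_quot S t.
  move: (congr1 (bc_unit (to_quot S)) e); rewrite restrE linearZ /=.
  by rewrite bc_unit_tens mul1r.
rewrite -[LHS]/(to_quot S _ * (bc_unit (to_quot S) (inv_val s) : quot S)).
by rewrite [in RHS]rmorphM -e exprD rmorphM mulrAC.
Qed.

Definition inv_mul (m : inv_ideal D M) (s : inv_ideal D S^o) : inv_ideal D M :=
  InvIdeal (inv_mul_subproof s m).

Lemma inv_mul_is_linear m : linear (inv_mul m).
Proof.
move=> a x y; apply: inv_inj; rewrite inv_valD inv_valZ.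
rewrite -[LHS]/(_ *: _) inv_valD inv_valZ.
rewrite restrE (linearP (bc_unit (to_quot S))) scalerDl -scalerA.
by [].
Qed.
HB.instance Definition _ m :=
  GRing.isLinear.Build S (inv_ideal D S^o) (inv_ideal D M) _
    (inv_mul m) (inv_mul_is_linear m).

Lemma inv_mul_in m (s : S) : inv_mul m (inv_in D (s : S^o)) = s *: m.
Proof.
by apply: inv_inj; rewrite inv_valZ /= bc_unit_tens mul1r.
Qed.
End InvertIdealProduct.

Section InvertIdealTheory.
Variables (S : comPzRingType) (D : set S).
Implicit Types M N P : lmodType S.

Lemma inv_map_comp M N P (g : {linear M -> N}) (h : {linear N -> P})
    (hg : {linear M -> P}) :
  (forall m, hg m = h (g m)) ->
  forall x, inv_map D hg x = inv_map D h (inv_map D g x).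
Proof. by move=> e x; apply: inv_inj; apply: bc_map_comp. Qed.

Lemma inv_map_id M (g : {linear M -> M}) :
  (forall m, g m = m) -> forall x, inv_map D g x = x.
Proof. by move=> e x; apply: inv_inj; apply: bc_map_id. Qed.

Lemma inv_mapD M N (g h gh : {linear M -> N}) :
  (forall m, gh m = g m + h m) ->
  forall x, inv_map D gh x = inv_map D g x + inv_map D h x.
Proof. by move=> e x; apply: inv_inj; rewrite inv_valD; apply: bc_mapD. Qed.

Lemma inv_map0 M N (g : {linear M -> N}) :
  (forall m, g m = 0) -> forall x, inv_map D g x = 0.
Proof. by move=> e x; apply: inv_inj; apply: bc_map0. Qed.

Lemma inv_map_bij M N (g : {linear M -> N}) :
  bijective g -> bijective (inv_map D g).
Proof.
move=> [h gK hK].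
have hl : linear h by move=> a x y; apply: (can_inj gK); rewrite linearP !hK.
pose hi := GRing.isLinear.Build S _ _ _ h hl.
pose h' : {linear N -> M} := HB.pack h hi.
exists (inv_map D h') => x.
  by rewrite -(inv_map_comp (hg := idfun)) ?inv_map_id // => m /=; rewrite gK.
by rewrite -(inv_map_comp (hg := idfun)) ?inv_map_id // => m /=; rewrite hK.
Qed.
End InvertIdealTheory.

(* What the theory of motives uses of A, R and kappa: the A-algebra
   S = A (x) R, its endomorphism tau, and the elements
   a (x) 1 - 1 (x) kappa a, for a in A \ F, that define M[j^-1]. *)
Record motive_base := MotiveBase {
  mb_A : comPzRingType;
  mb_S : comPzRingType;
  mb_in : {rmorphism mb_A -> mb_S};
  mb_tau : {rmorphism mb_S -> mb_S};
  mb_tau_in : forall a, mb_tau (mb_in a) = mb_in a;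
  mb_gen : set mb_S }.
Arguments mb_in : clear implicits.
Arguments mb_tau : clear implicits.
Arguments mb_gen : clear implicits.

Lemma linear_funext (S : comPzRingType) (M N : lmodType S)
  (f g : {linear M -> N}) : f =1 g -> f = g.
Proof.
move: f g => [f [[f1] [f2]]] [g [[g1] [g2]]] /funext/= e; subst g.
by rewrite (Prop_irrelevance f1 g1) (Prop_irrelevance f2 g2).
Qed.

Section DiagonalMaps.
Variables (S : comPzRingType) (M N M' N' : lmodType S).
Definition diag_mod (m : M) : M * M := (m, m).
Definition codiag_mod (x : M * M) : M := x.1 + x.2.
Definition sum_mod (g : {linear M -> N}) (h : {linear M' -> N'}) (x : M * M')
  : N * N' := (g x.1, h x.2).
Lemma diag_mod_is_linear : linear diag_mod. Proof. by []. Qed.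
Lemma codiag_mod_is_linear : linear codiag_mod.
Proof. by move=> a x y; rewrite /codiag_mod /= scalerDr addrACA. Qed.
Variables (g : {linear M -> N}) (h : {linear M' -> N'}).
Lemma sum_mod_is_linear : linear (sum_mod g h).
Proof. by move=> a x y; rewrite /sum_mod /= !linearP. Qed.
HB.instance Definition _ :=
  GRing.isLinear.Build S M (M * M)%type _ diag_mod diag_mod_is_linear.
HB.instance Definition _ :=
  GRing.isLinear.Build S (M * M)%type M _ codiag_mod codiag_mod_is_linear.
HB.instance Definition _ :=
  GRing.isLinear.Build S (M * M')%type (N * N')%type _
    (sum_mod g h) sum_mod_is_linear.
End DiagonalMaps.

Section Twist.
Variable B : motive_base.
Local Notation S := (mb_S B).

(* tau^*M *)
Definition twist (M : lmodType S) : lmodType S := bc (mb_tau B) M.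

(* M[j^-1] and (tau^*M)[j^-1] *)
Definition jinv (M : lmodType S) : lmodType S := inv_ideal (mb_gen B) M.

Definition jin {M : lmodType S} : {linear M -> jinv M} := inv_in (mb_gen B).
Definition jmap {M N : lmodType S} (g : {linear M -> N}) :
  {linear jinv M -> jinv N} := inv_map (mb_gen B) g.
Definition twist_map {M N : lmodType S} (g : {linear M -> N}) :
  {linear twist M -> twist N} := bc_map (mb_tau B) g.
(* the canonical isomorphism 1 : tau^*S -> S *)
Definition twist_one : {linear twist S^o -> S^o} := bc_unit (mb_tau B).

Implicit Types M N P : lmodType S.

Lemma jmap_comp M N P (g : {linear M -> N}) (h : {linear N -> P})
    (hg : {linear M -> P}) : (forall m, hg m = h (g m)) ->
  forall x, jmap h (jmap g x) = jmap hg x.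
Proof. by move=> e x; symmetry; apply: inv_map_comp. Qed.
Lemma jmap_id M (g : {linear M -> M}) :
  (forall m, g m = m) -> forall x, jmap g x = x.
Proof. by move=> e; apply: inv_map_id. Qed.
Lemma jmapD M N (g h gh : {linear M -> N}) :
  (forall m, gh m = g m + h m) -> forall x, jmap gh x = jmap g x + jmap h x.
Proof. by move=> e; apply: inv_mapD. Qed.
Lemma jmap0 M N (g : {linear M -> N}) :
  (forall m, g m = 0) -> forall x, jmap g x = 0.
Proof. by move=> e; apply: inv_map0. Qed.

Lemma jmapZ M N (g h : {linear M -> N}) c :
  (forall m, h m = c *: g m) -> forall x, jmap h x = c *: jmap g x.
Proof.
move=> e x; apply: inv_inj; rewrite inv_valZ restrE.
rewrite -[LHS]/(bc_map (to_quot _) h (inv_val x)).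
rewrite -[inv_val (jmap g x)]/(bc_map (to_quot _) g (inv_val x)).
move: (inv_val x); apply: bc_ext => [u v|u v||b m].
- by rewrite raddfD.
- by rewrite raddfD scalerDr.
- by rewrite !raddf0 ?scaler0.
- by rewrite !bc_map_tens bc_tensZ e -bc_tens_bal mulrC.
Qed.

Definition tjmap {M N : lmodType S} (g : {linear M -> N}) :
  {linear jinv (twist M) -> jinv (twist N)} := jmap (twist_map g).

Lemma tjmap_comp M N P (g : {linear M -> N}) (h : {linear N -> P})
    (hg : {linear M -> P}) : (forall m, hg m = h (g m)) ->
  forall x, tjmap h (tjmap g x) = tjmap hg x.
Proof. by move=> e; apply: jmap_comp => m; apply: bc_map_comp. Qed.
Lemma tjmap_id M (g : {linear M -> M}) :
  (forall m, g m = m) -> forall x, tjmap g x = x.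
Proof. by move=> e; apply: jmap_id; apply: bc_map_id. Qed.
Lemma tjmapD M N (g h gh : {linear M -> N}) :
  (forall m, gh m = g m + h m) ->
  forall x, tjmap gh x = tjmap g x + tjmap h x.
Proof. by move=> e; apply: jmapD; apply: bc_mapD. Qed.
Lemma tjmap0 M N (g : {linear M -> N}) :
  (forall m, g m = 0) -> forall x, tjmap g x = 0.
Proof. by move=> e; apply: jmap0; apply: bc_map0. Qed.

Lemma tjmapZ M N (g h : {linear M -> N}) c :
  (forall m, h m = c *: g m) ->
  forall x, tjmap h x = mb_tau B c *: tjmap g x.
Proof.
move=> e; apply: jmapZ; apply: bc_ext => [u v|u v||b m].
- by rewrite raddfD.
- by rewrite raddfD scalerDr.
- by rewrite !raddf0 ?scaler0.
- by rewrite [LHS]bc_map_tens [X in _ *: X]bc_map_tens bc_tensZ e -bc_tens_bal mulrC.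
Qed.

Definition fstl {M N} : {linear (M * N)%type -> M} := fst.
Definition sndl {M N} : {linear (M * N)%type -> N} := snd.
Definition inll {M N} : {linear M -> (M * N)%type} := inl_mod N.
Definition inrl {M N} : {linear N -> (M * N)%type} := inr_mod M.

Lemma jmap_pair M N (x : jinv (M * N)%type) :
  jmap inll (jmap fstl x) + jmap inrl (jmap sndl x) = x.
Proof.
rewrite (jmap_comp (hg := inll \o fstl)) // (jmap_comp (hg := inrl \o sndl)) //.
rewrite -(jmapD (gh := idfun)) ?jmap_id // => m /=.
by rewrite inlr_mod.
Qed.
Lemma tjmap_pair M N (x : jinv (twist (M * N)%type)) :
  tjmap inll (tjmap fstl x) + tjmap inrl (tjmap sndl x) = x.
Proof.
rewrite (tjmap_comp (hg := inll \o fstl)) // (tjmap_comp (hg := inrl \o sndl)) //.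
rewrite -(tjmapD (gh := idfun)) ?tjmap_id // => m /=.
by rewrite inlr_mod.
Qed.
Lemma jmap_pair_inj M N (x y : jinv (M * N)%type) :
  jmap fstl x = jmap fstl y -> jmap sndl x = jmap sndl y -> x = y.
Proof. by move=> e e'; rewrite -(jmap_pair x) -(jmap_pair y) e e'. Qed.

Section PairK.
Variables M N : lmodType S.
Lemma jmap_fst_inl (x : jinv M) : jmap (@fstl M N) (jmap inll x) = x.
Proof. by rewrite (jmap_comp (hg := idfun)) ?jmap_id. Qed.
Lemma jmap_snd_inr (x : jinv N) : jmap (@sndl M N) (jmap inrl x) = x.
Proof. by rewrite (jmap_comp (hg := idfun)) ?jmap_id. Qed.
Lemma jmap_fst_inr (x : jinv N) : jmap (@fstl M N) (jmap inrl x) = 0.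
Proof. by rewrite (jmap_comp (hg := \0)) ?jmap0. Qed.
Lemma jmap_snd_inl (x : jinv M) : jmap (@sndl M N) (jmap inll x) = 0.
Proof. by rewrite (jmap_comp (hg := \0)) ?jmap0. Qed.
Lemma tjmap_fst_inl x : tjmap (@fstl M N) (tjmap inll x) = x.
Proof. by rewrite (tjmap_comp (hg := idfun)) ?tjmap_id. Qed.
Lemma tjmap_snd_inr x : tjmap (@sndl M N) (tjmap inrl x) = x.
Proof. by rewrite (tjmap_comp (hg := idfun)) ?tjmap_id. Qed.
Lemma tjmap_fst_inr x : tjmap (@fstl M N) (tjmap inrl x) = 0.
Proof. by rewrite (tjmap_comp (hg := \0)) ?tjmap0. Qed.
Lemma tjmap_snd_inl x : tjmap (@sndl M N) (tjmap inll x) = 0.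
Proof. by rewrite (tjmap_comp (hg := \0)) ?tjmap0. Qed.
End PairK.
End Twist.
Arguments fstl {B M N}.
Arguments sndl {B M N}.
Arguments inll {B M N}.
Arguments inrl {B M N}.
Arguments jin {B M}.
Arguments jmap : simpl never.
Arguments twist_map : simpl never.
Arguments tjmap : simpl never.

Record motive (B : motive_base) := Motive {
  mot_mod :> lmodType (mb_S B);
  mot_locally_free : locally_free mot_mod;
  mot_tau : {linear jinv (twist mot_mod) -> jinv mot_mod};
  mot_tau_bij : bijective mot_tau }.
Arguments mot_tau {B m}.

Record mhom (B : motive_base) (M N : motive B) := MHom {
  mhom_fun :> {linear M -> N};
  mhomP : forall x : jinv (twist M),
    jmap mhom_fun (mot_tau x) = mot_tau (tjmap mhom_fun x) }.

Section HomModule.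
Variables (B : motive_base) (M N : motive B).
Local Notation A := (mb_A B).

Lemma mhom_ext (f g : mhom M N) : f =1 g -> f = g.
Proof.
move: f g => [f fP] [g gP] /= /linear_funext e; subst g.
by rewrite (Prop_irrelevance fP gP).
Qed.

HB.instance Definition _ := gen_eqMixin (mhom M N).
HB.instance Definition _ := gen_choiceMixin (mhom M N).

Let zeroP x : jmap (\0 : {linear M -> N}) (mot_tau x)
  = mot_tau (tjmap (\0 : {linear M -> N}) x).
Proof. by rewrite jmap0 // tjmap0 // linear0. Qed.
Let zero : mhom M N := MHom zeroP.

Let addP (f g : mhom M N) x : jmap (f \+ g) (mot_tau x) = mot_tau (tjmap (f \+ g) x).
Proof. by rewrite (jmapD (g := f) (h := g)) // (tjmapD (g := f) (h := g)) // linearD !mhomP. Qed.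
Let add f g : mhom M N := MHom (addP f g).

Let scaleP a (f : mhom M N) x :
  jmap (mb_in B a \*: f) (mot_tau x) = mot_tau (tjmap (mb_in B a \*: f) x).
Proof.
rewrite (jmapZ (g := f) (c := mb_in B a)) //.
by rewrite (tjmapZ (g := f) (c := mb_in B a)) // mb_tau_in linearZ mhomP.
Qed.
Let scale a f : mhom M N := MHom (scaleP a f).
Let opp f := scale (-1) f.

Let addA : associative add.
Proof. by move=> f g h; apply: mhom_ext => x /=; rewrite addrA. Qed.
Let addC : commutative add.
Proof. by move=> f g; apply: mhom_ext => x /=; rewrite addrC. Qed.
Let add0 : left_id zero add.
Proof. by move=> f; apply: mhom_ext => x /=; rewrite add0r. Qed.
Let addN : left_inverse zero opp add.
Proof.
by move=> f; apply: mhom_ext => x /=; rewrite rmorphN1 scaleN1r addNr.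
Qed.
HB.instance Definition _ := GRing.isZmodule.Build (mhom M N) addA addC add0 addN.

Let scaleA a b f : scale a (scale b f) = scale (a * b) f.
Proof. by apply: mhom_ext => x /=; rewrite scalerA rmorphM. Qed.
Let scale1 : left_id 1 scale.
Proof. by move=> f; apply: mhom_ext => x /=; rewrite rmorph1 scale1r. Qed.
Let scaleDr : right_distributive scale +%R.
Proof. by move=> a f g; apply: mhom_ext => x /=; rewrite scalerDr. Qed.
Let scaleDl f : {morph scale^~ f : a b / a + b}.
Proof. by move=> a b; apply: mhom_ext => x /=; rewrite rmorphD scalerDl. Qed.
HB.instance Definition _ :=
  GRing.Zmodule_isLmodule.Build A (mhom M N) scaleA scale1 scaleDr scaleDl.

Lemma mhom0E x : (0 : mhom M N) x = 0. Proof. by []. Qed.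
Lemma mhomDE (f g : mhom M N) x : (f + g) x = f x + g x. Proof. by []. Qed.
Lemma mhomZE a (f : mhom M N) x : (a *: f) x = mb_in B a *: f x.
Proof. by []. Qed.
End HomModule.

Section MotiveConstructions.
Variable B : motive_base.
Local Notation A := (mb_A B).
Local Notation S := (mb_S B).
Implicit Types M N K : motive B.

Lemma mhom_idP M (x : jinv (twist M)) :
  jmap (idfun : {linear M -> M}) (mot_tau x) =
    mot_tau (tjmap (idfun : {linear M -> M}) x).
Proof. by rewrite jmap_id // tjmap_id. Qed.
Definition mhom_id M : mhom M M := MHom (@mhom_idP M).

Lemma mot_unit_bij : bijective (jmap (@twist_one B)).
Proof. by apply: inv_map_bij; apply: bc_unit_bij. Qed.
Definition mot_unit : motive B :=
  Motive (locally_free_regular S) mot_unit_bij.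

Lemma mot_zero_bij :
  bijective (\0 : {linear jinv (twist ('rV[S]_0 : lmodType S)) ->
                          jinv ('rV[S]_0 : lmodType S)}).
Proof.
have z (g : {linear ('rV[S]_0 : lmodType S) -> ('rV[S]_0 : lmodType S)}) m :
  g m = 0 by apply/rowP => -[].
exists (fun=> 0) => x.
- rewrite -[RHS](tjmap_id (g := idfun)) //.
  by rewrite (tjmap0 (g := idfun)) // => m; apply: (z idfun).
- rewrite -[RHS](jmap_id (g := idfun)) //.
  by rewrite (jmap0 (g := idfun)) // => m; apply: (z idfun).
Qed.
Definition mot_zero : motive B := Motive (locally_free0 S) mot_zero_bij.

(* The module M (+) N with the endomorphism given by the matrix
     tau_M   u
       0   tau_N
   for a linear map u : (tau^*N)[j^-1] -> M[j^-1]. *)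
Section MotExt.
Variables (M N : motive B) (u : {linear jinv (twist N) -> jinv M}).

Definition mot_ext_tau (y : jinv (twist (M * N)%type)) : jinv (M * N)%type :=
  jmap inll (mot_tau (tjmap fstl y) + u (tjmap sndl y))
  + jmap inrl (mot_tau (tjmap sndl y)).
Lemma mot_ext_tau_is_linear : linear mot_ext_tau.
Proof.
move=> a x y; rewrite /mot_ext_tau !linearP [in RHS]scalerDr [RHS]addrACA.
congr (_ + _).
rewrite -[RHS](linearP (jmap inll)); congr (jmap _ _).
by rewrite scalerDr addrACA.
Qed.
HB.instance Definition _ :=
  GRing.isLinear.Build S _ _ _ mot_ext_tau mot_ext_tau_is_linear.

Lemma mot_ext_tau_fst y :
  jmap fstl (mot_ext_tau y) = mot_tau (tjmap fstl y) + u (tjmap sndl y).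
Proof. by rewrite linearD /= jmap_fst_inl jmap_fst_inr addr0. Qed.
Lemma mot_ext_tau_snd y : jmap sndl (mot_ext_tau y) = mot_tau (tjmap sndl y).
Proof. by rewrite linearD /= jmap_snd_inl jmap_snd_inr add0r. Qed.

Lemma mot_ext_tau_bij : bijective mot_ext_tau.
Proof.
have [g gK Kg] := mot_tau_bij M; have [h hK Kh] := mot_tau_bij N.
exists (fun z => tjmap inll (g (jmap fstl z - u (h (jmap sndl z))))
  + tjmap inrl (h (jmap sndl z))) => z.
  rewrite mot_ext_tau_fst mot_ext_tau_snd hK addrK gK.
  exact: tjmap_pair.
apply: jmap_pair_inj; rewrite ?mot_ext_tau_fst ?mot_ext_tau_snd.
  rewrite !linearD /= tjmap_fst_inl tjmap_fst_inr tjmap_snd_inl tjmap_snd_inr.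
  by rewrite !linear0 !addr0 !add0r Kg subrK.
by rewrite !linearD /= tjmap_snd_inl tjmap_snd_inr !linear0 add0r Kh.
Qed.

Definition mot_ext : motive B :=
  Motive (locally_free_prod (mot_locally_free M) (mot_locally_free N))
    mot_ext_tau_bij.

Lemma mot_ext_inlP x :
  jmap inll (mot_tau x) = mot_tau (m := mot_ext) (tjmap (@inll B M N) x).
Proof.
apply: jmap_pair_inj.
  rewrite [RHS]mot_ext_tau_fst jmap_fst_inl tjmap_fst_inl tjmap_snd_inl.
  by rewrite linear0 addr0.
by rewrite [RHS]mot_ext_tau_snd jmap_snd_inl tjmap_snd_inl linear0.
Qed.
Definition mot_ext_inl : mhom M mot_ext := @MHom B M mot_ext inll mot_ext_inlP.

Lemma mot_ext_sndP x :
  jmap (@sndl B M N) (mot_tau (m := mot_ext) x) = mot_tau (tjmap sndl x).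
Proof. exact: mot_ext_tau_snd. Qed.
Definition mot_ext_snd : mhom mot_ext N := @MHom B mot_ext N sndl mot_ext_sndP.
End MotExt.

(* Short exact sequences 0 -> M -> E -> N -> 0 *)
Record ses N M := Ses {
  ses_mid : motive B;
  ses_inj : mhom M ses_mid;
  ses_surj : mhom ses_mid N;
  ses_injP : injective ses_inj;
  ses_exact : forall e, ses_surj e = 0 <-> exists m, ses_inj m = e;
  ses_surjP : forall n, exists e, ses_surj e = n }.

Section MotExtSes.
Variables (M N : motive B) (u : {linear jinv (twist N) -> jinv M}).
Lemma mot_ext_ses_inj : injective (mot_ext_inl u).
Proof. by move=> x y []. Qed.
Lemma mot_ext_ses_exact (e : mot_ext u) :
  mot_ext_snd u e = 0 <-> exists m, mot_ext_inl u m = e.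
Proof.
split=> [|[m <-] //]; case: e => m n /= e; exists m.
by congr pair; rewrite -e.
Qed.
Lemma mot_ext_ses_surj n : exists e, mot_ext_snd u e = n.
Proof. by exists (0, n). Qed.
Definition mot_ext_ses : ses N M :=
  Ses mot_ext_ses_inj mot_ext_ses_exact mot_ext_ses_surj.
End MotExtSes.

Definition mot_sum M N : motive B := mot_ext (\0 : {linear jinv (twist N) -> jinv M}).

Lemma mhom_diagP M x :
  jmap (@diag_mod S M) (mot_tau x) =
    mot_tau (m := mot_sum M M) (tjmap (@diag_mod S M) x).
Proof.
apply: jmap_pair_inj.
  rewrite [RHS]mot_ext_tau_fst addr0 (jmap_comp (hg := idfun)) // jmap_id //.
  by rewrite (tjmap_comp (hg := idfun)) // tjmap_id.
rewrite [RHS]mot_ext_tau_snd (jmap_comp (hg := idfun)) // jmap_id //.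
by rewrite (tjmap_comp (hg := idfun)) // tjmap_id.
Qed.
Definition mhom_diag M : mhom M (mot_sum M M) := @MHom B M (mot_sum M M) (@diag_mod S M) (@mhom_diagP M).

Lemma mhom_codiagP M x :
  jmap (@codiag_mod S M) (mot_tau (m := mot_sum M M) x) =
    mot_tau (tjmap (@codiag_mod S M) x).
Proof.
rewrite (jmapD (g := fstl) (h := sndl)) // (tjmapD (g := fstl) (h := sndl)) //.
by rewrite [X in X + _]mot_ext_tau_fst [X in _ + X]mot_ext_tau_snd addr0 linearD.
Qed.
Definition mhom_codiag M : mhom (mot_sum M M) M := @MHom B (mot_sum M M) M (@codiag_mod S M) (@mhom_codiagP M).

Lemma mhom_sumP M N M' N' (g : mhom M N) (h : mhom M' N') x :
  jmap (sum_mod g h) (mot_tau (m := mot_sum M M') x) =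
    mot_tau (m := mot_sum N N') (tjmap (sum_mod g h) x).
Proof.
apply: jmap_pair_inj.
  rewrite [RHS]mot_ext_tau_fst addr0 (jmap_comp (hg := g \o fstl)) //.
  rewrite -(jmap_comp (g := fstl) (h := g)) // [X in jmap g X]mot_ext_tau_fst addr0.
  by rewrite mhomP !(tjmap_comp (hg := g \o fstl)).
rewrite [RHS]mot_ext_tau_snd (jmap_comp (hg := h \o sndl)) //.
rewrite -(jmap_comp (g := sndl) (h := h)) // [X in jmap h X]mot_ext_tau_snd.
by rewrite mhomP !(tjmap_comp (hg := h \o sndl)).
Qed.
Definition mhom_sum M N M' N' (g : mhom M N) (h : mhom M' N') :
  mhom (mot_sum M M') (mot_sum N N') := 
  @MHom B (mot_sum M M') (mot_sum N N') (sum_mod g h) (mhom_sumP g h).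

Section SesSum.
Variables (N M N' M' : motive B) (E : ses N M) (E' : ses N' M').
Let i := mhom_sum (ses_inj E) (ses_inj E').
Let p := mhom_sum (ses_surj E) (ses_surj E').
Lemma ses_sum_inj : injective i.
Proof. by move=> [x y] [x' y'] [] /ses_injP -> /ses_injP ->. Qed.
Lemma ses_sum_exact e : p e = 0 <-> exists m, i m = e.
Proof.
case: e => e e'; split=> [[/ses_exact[m <-] /ses_exact[m' <-]]|[[m m'] [<- <-]]].
  by exists (m, m').
by congr pair; apply/ses_exact; [exists m|exists m'].
Qed.
Lemma ses_sum_surj n : exists e, p e = n.
Proof.
case: n => n n'; have [e <-] := ses_surjP E n; have [e' <-] := ses_surjP E' n'.
by exists (e, e').
Qed.
Definition ses_sum : ses (mot_sum N N') (mot_sum M M') :=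
  Ses ses_sum_inj ses_sum_exact ses_sum_surj.
End SesSum.

(* 0 -> 0 -> N -> N -> 0 *)
Section SesId.
Variable N : motive B.
Lemma ses_id_inj : injective (0 : mhom mot_zero N).
Proof. by move=> x y _; apply/rowP => -[]. Qed.
Lemma ses_id_exact e : mhom_id N e = 0 <-> exists m, (0 : mhom mot_zero N) m = e.
Proof. by split=> [e0|[m <-]] //; exists 0; symmetry; apply: e0. Qed.
Lemma ses_id_surj n : exists e, mhom_id N e = n. Proof. by exists n. Qed.
Definition ses_id : ses N mot_zero := Ses ses_id_inj ses_id_exact ses_id_surj.
End SesId.
End MotiveConstructions.

Section Yoneda.
Variable B : motive_base.
Local Notation A := (mb_A B).
Local Notation S := (mb_S B).
Implicit Types M N K : motive B.

(* Exact sequences 0 -> M -> E_n -> ... -> E_0 -> N -> 0 in the exact category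
   of motives, i.e. splices of n.+1 short exact sequences. *)
Fixpoint yseq (n : nat) N M : Type :=
  match n with
  | 0 => ses N M
  | n'.+1 => {K : motive B & (ses N K * yseq n' K M)%type}
  end.

(* The i-extensions of N by M; for i = 0 these are the morphisms. *)
Definition yext (i : nat) N M : Type :=
  match i with 0 => mhom N M | n.+1 => yseq n N M end.

(* Morphisms of i-extensions with prescribed maps on the two end terms. *)
Definition ses_mor N M N' M' (g : mhom N N') (f : mhom M M')
    (E : ses N M) (E' : ses N' M') : Prop :=
  exists h : mhom (ses_mid E) (ses_mid E'),
    (forall m, h (ses_inj E m) = ses_inj E' (f m)) /\
    (forall e, ses_surj E' (h e) = g (ses_surj E e)).

Fixpoint yseq_mor (n : nat) : forall N M N' M' (g : mhom N N')
    (f : mhom M M'), yseq n N M -> yseq n N' M' -> Prop :=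
  match n return forall N M N' M' (g : mhom N N') (f : mhom M M'),
      yseq n N M -> yseq n N' M' -> Prop with
  | 0 => @ses_mor
  | n'.+1 => fun N M N' M' g f E E' =>
      exists k : mhom (projT1 E) (projT1 E'),
        ses_mor g k (projT2 E).1 (projT2 E').1 /\
        yseq_mor k f (projT2 E).2 (projT2 E').2
  end.

Definition yext_mor (i : nat) N M N' M' (g : mhom N N') (f : mhom M M') :
    yext i N M -> yext i N' M' -> Prop :=
  match i return yext i N M -> yext i N' M' -> Prop with
  | 0 => fun e e' => forall x, f (e x) = e' (g x)
  | n.+1 => @yseq_mor n N M N' M' g f
  end.

Fixpoint yseq_sum (n : nat) : forall N M N' M',
    yseq n N M -> yseq n N' M' -> yseq n (mot_sum N N') (mot_sum M M') :=
  match n return forall N M N' M',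
    yseq n N M -> yseq n N' M' -> yseq n (mot_sum N N') (mot_sum M M') with
  | 0 => @ses_sum B
  | n'.+1 => fun N M N' M' E E' =>
      existT _ (mot_sum (projT1 E) (projT1 E'))
        (ses_sum (projT2 E).1 (projT2 E').1,
         yseq_sum (projT2 E).2 (projT2 E').2)
  end.

Definition yext_sum (i : nat) N M N' M' :
    yext i N M -> yext i N' M' -> yext i (mot_sum N N') (mot_sum M M') :=
  match i return
    yext i N M -> yext i N' M' -> yext i (mot_sum N N') (mot_sum M M') with
  | 0 => @mhom_sum B N M N' M'
  | n.+1 => @yseq_sum n N M N' M'
  end.

(* 0 -> M -> M (+) N -> N -> 0 in degree 1 and
   0 -> M -> M -> 0 -> ... -> 0 -> N -> N -> 0 in higher degrees *)
Fixpoint yseq_zero (n : nat) N M : yseq n N M :=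
  match n return yseq n N M with
  | 0 => mot_ext_ses (\0 : {linear jinv (twist N) -> jinv M})
  | n'.+1 => existT _ (mot_zero B) (ses_id N, yseq_zero n' (mot_zero B) M)
  end.

Definition yext_zero (i : nat) N M : yext i N M :=
  match i return yext i N M with
  | 0 => 0 : mhom N M
  | n.+1 => yseq_zero n N M
  end.

(* Yoneda equivalence: the equivalence relation generated by the morphisms of
   extensions that are the identity on both end terms. *)
Definition yext_equiv (i : nat) N M : yext i N M -> yext i N M -> Prop :=
  clos_refl_sym_trans _ (yext_mor (mhom_id N) (mhom_id M)).

(* Elements of Ext^i(N, M) are Yoneda classes, that is, predicates on
   yext i N M; Ext i N M is the collection of all classes.  (The type [set] of
   classical_sets lives in too small a universe to be used here.) *)
Definition yclass (i : nat) N M : Type := yext i N M -> Prop.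

Definition ext_class (i : nat) N M (E : yext i N M) : yclass i N M :=
  fun E' => yext_equiv E E'.

Definition Ext (i : nat) N M (X : yclass i N M) : Prop :=
  exists E, X = ext_class E.

Definition ext_zero (i : nat) N M : yclass i N M :=
  ext_class (yext_zero i N M).

(* The class f_* X: the extensions E' of N by M' that are pushouts along
   f : M -> M' of extensions in X are those receiving a morphism (f, id_N). *)
Definition ext_push (i : nat) N M M' (f : mhom M M') (X : yclass i N M) : yclass i N M' :=
  fun E' => exists E E1, [/\ X E, yext_mor (mhom_id N) f E E1 & yext_equiv E1 E'].

(* Baer sum: the pushforward along the codiagonal M (+) M -> M of the pullback
   P along the diagonal N -> N (+) N of the direct sum of extensions. *)
Definition ext_add (i : nat) N M (X Y : yclass i N M) : yclass i N M :=
  fun E' => exists E1 E2 (P : yext i N (mot_sum M M)) E3,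
     [/\ X E1 /\ Y E2,
         yext_mor (mhom_diag N) (mhom_id (mot_sum M M)) P (yext_sum E1 E2),
         yext_mor (mhom_id N) (mhom_codiag M) P E3 &
         yext_equiv E3 E'].

Definition ext_scale (i : nat) N M (a : A) (X : yclass i N M) :
    yclass i N M :=
  ext_push (a *: mhom_id M) X.

End Yoneda.
Arguments yext_zero {B} i N M.
Arguments Ext {B} i N M X.
Arguments ext_zero {B} i N M.

(* M and M[j^-1], as A-modules *)
Definition mot_A (B : motive_base) (M : motive B) : lmodType (mb_A B) :=
  restr (mb_in B) M.
Definition jinv_A (B : motive_base) (M : motive B) : lmodType (mb_A B) :=
  restr (mb_in B) (jinv M).

Section Complex.
Variables (B : motive_base) (M : motive B).
Local Notation A := (mb_A B).
Local Notation S := (mb_S B).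

Lemma hom_ev_is_linear :
  linear (fun f : mhom (mot_unit B) M => f (1 : S) : mot_A M).
Proof. by []. Qed.

Definition hom_ev (f : mhom (mot_unit B) M) : mot_A M := f (1 : S).
HB.instance Definition _ :=
  GRing.isLinear.Build A (mhom (mot_unit B) M) (mot_A M) _
    hom_ev hom_ev_is_linear.

(* id - tau_M : M -> M[j^-1] *)
Definition mot_diff (m : mot_A M) : jinv_A M :=
  jin (m : M) - mot_tau (jin (bc_in (mb_tau B) (m : M) : twist M)).

Lemma mot_diff_is_linear : linear mot_diff.
Proof.
move=> a x y.
have bcE : bc_in (mb_tau B) (mb_in B a *: (x : M) + y) =
    mb_in B a *: (bc_in (mb_tau B) (x : M) : twist M) + bc_in (mb_tau B) (y : M).
  by rewrite /bc_in bc_tensDr -bc_tens_bal mul1r mb_tau_in bc_tensZ mulr1.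
rewrite -[LHS]/(jin (mb_in B a *: (x : M) + y) -
  mot_tau (jin (bc_in (mb_tau B) (mb_in B a *: (x : M) + y) : twist M))).
rewrite bcE !linearP -[RHS]/(mb_in B a *: (jin (x : M) -
  mot_tau (jin (bc_in (mb_tau B) (x : M) : twist M))) + mot_diff y).
by rewrite scalerDr addrACA.
Qed.
HB.instance Definition _ :=
  GRing.isLinear.Build A (mot_A M) (jinv_A M) _
    mot_diff mot_diff_is_linear.

(* m . 1 : (tau^*S)[j^-1] -> M[j^-1] *)
Definition dot_one (m : jinv M) : {linear jinv (twist S^o) -> jinv M} :=
  inv_mul m \o jmap (twist_one B).

Definition ext_iota_ses (m : jinv M) : yext 1 (mot_unit B) M :=
  mot_ext_ses (N := mot_unit B) (dot_one m).

Definition ext_iota (m : jinv_A M) : yclass 1 (mot_unit B) M :=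
  ext_class (ext_iota_ses m).
End Complex.

Section TensorRing.
Variables (k A R : comPzRingType).
Variables (iA : {rmorphism k -> A}) (iR : {rmorphism k -> R}).

Definition tens : Type := bc iA (restr iR R^o).
HB.instance Definition _ := GRing.Zmodule.on tens.

Definition pure (a : A) (r : R) : tens := bc_tens iA a (r : restr iR R^o).

Lemma tens_ind (P : tens -> Prop) :
  P 0 -> (forall a r, P (pure a r)) ->
  (forall x y, P x -> P y -> P (x + y)) -> forall x, P x.
Proof. by move=> P0 Pt PD; apply: (@bc_ind _ _ iA (restr iR R^o)). Qed.

Lemma pureDl a a' r : pure (a + a') r = pure a r + pure a' r.
Proof. exact: bc_tensDl. Qed.
Lemma pureDr a r r' : pure a (r + r') = pure a r + pure a r'.
Proof. exact: bc_tensDr. Qed.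
Lemma pure_bal a c r : pure (a * iA c) r = pure a (iR c * r).
Proof. exact: bc_tens_bal. Qed.

Section TensLift.
Variables (W : zmodType) (g : A -> R -> W).
Hypotheses (gDl : forall r, {morph g^~ r : a b / a + b})
  (gDr : forall a, {morph g a : r s / r + s})
  (g_bal : forall a c r, g (a * iA c) r = g a (iR c * r)).
Definition tens_lift : tens -> W := @bc_lift _ _ iA (restr iR R^o) W g.
Lemma tens_lift_pure a r : tens_lift (pure a r) = g a r.
Proof. exact: bc_lift_tens. Qed.
Lemma tens_liftD : {morph tens_lift : x y / x + y}.
Proof. exact: bc_liftD. Qed.
Lemma tens_lift0 : tens_lift 0 = 0.
Proof. by apply: (addIr (tens_lift 0)); rewrite add0r -tens_liftD addr0. Qed.
End TensLift.

Let mul1 (a : A) (r : R) : tens -> tens :=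
  tens_lift (fun a' r' => pure (a * a') (r * r')).

Let mul1_pure a r a' r' : mul1 a r (pure a' r') = pure (a * a') (r * r').
Proof.
rewrite /mul1 tens_lift_pure // => [s b b'|b s s'|b c s].
- by rewrite mulrDr pureDl.
- by rewrite mulrDr pureDr.
- by rewrite mulrA pure_bal mulrCA.
Qed.
Let mul1D a r : {morph mul1 a r : x y / x + y}.
Proof.
apply: tens_liftD => [s b b'|b s s'|b c s].
- by rewrite mulrDr pureDl.
- by rewrite mulrDr pureDr.
- by rewrite mulrA pure_bal mulrCA.
Qed.
Let mul10 a r : mul1 a r 0 = 0.
Proof. by apply: (addIr (mul1 a r 0)); rewrite add0r -mul1D addr0. Qed.

Let mul (x y : tens) : tens := tens_lift (fun a r => mul1 a r y) x.

Let mul_pureE a r y : mul (pure a r) y = mul1 a r y.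
Proof.
rewrite /mul tens_lift_pure // => [s b b'|b s s'|b c s];
  elim/tens_ind: y => [|a' r'|x y hx hy]; rewrite ?mul10 ?addr0 //.
- by rewrite !mul1_pure mulrDl pureDl.
- by rewrite !mul1D hx hy addrACA.
- by rewrite !mul1_pure mulrDl pureDr.
- by rewrite !mul1D hx hy addrACA.
- by rewrite !mul1_pure mulrAC pure_bal mulrA.
- by rewrite !mul1D hx hy.
Qed.
Let mulDl : left_distributive mul +%R.
Proof.
move=> x y z; rewrite /mul; apply: tens_liftD => [s b b'|b s s'|b c s];
  elim/tens_ind: z => [|a' r'|u v hx hy]; rewrite ?mul10 ?addr0 //.
- by rewrite !mul1_pure mulrDl pureDl.
- by rewrite !mul1D hx hy addrACA.
- by rewrite !mul1_pure mulrDl pureDr.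
- by rewrite !mul1D hx hy addrACA.
- by rewrite !mul1_pure mulrAC pure_bal mulrA.
- by rewrite !mul1D hx hy.
Qed.
Let mul0l x : mul 0 x = 0.
Proof. by apply: (addIr (mul 0 x)); rewrite add0r -mulDl addr0. Qed.
Let mul_pure a r a' r' : mul (pure a r) (pure a' r') = pure (a * a') (r * r').
Proof. by rewrite mul_pureE mul1_pure. Qed.
Let mulDr x : {morph mul x : y z / y + z}.
Proof.
move=> y z; elim/tens_ind: x => [|a r|u v hu hv].
- by rewrite !mul0l addr0.
- by rewrite !mul_pureE mul1D.
- by rewrite !mulDl hu hv addrACA.
Qed.
Let mul0r x : mul x 0 = 0.
Proof. by apply: (addIr (mul x 0)); rewrite add0r -mulDr addr0. Qed.
Let mulC : commutative mul.
Proof.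
move=> x y; elim/tens_ind: x => [|a r|u v hu hv].
- by rewrite mul0l mul0r.
- elim/tens_ind: y => [|b s|u v hu hv]; first by rewrite mul0l mul0r.
    by rewrite !mul_pure mulrC [r * s]mulrC.
  by rewrite mulDl mulDr hu hv.
- by rewrite mulDl mulDr hu hv.
Qed.
Let mulA : associative mul.
Proof.
move=> x y z; elim/tens_ind: x => [|a r|u v hu hv].
- by rewrite !mul0l.
- elim/tens_ind: y => [|b s|u v hu hv]; first by rewrite mul0r !mul0l mul0r.
    elim/tens_ind: z => [|c t|u v hu hv]; first by rewrite !mul0r.
      by rewrite !mul_pure !mulrA.
    by rewrite !mulDr hu hv.
  by rewrite mulDl !mulDr hu hv mulDl.
- by rewrite !mulDl hu hv.
Qed.
Let mul1l : left_id (pure 1 1) mul.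
Proof.
move=> x; elim/tens_ind: x => [|a r|u v hu hv].
- by rewrite mul0r.
- by rewrite mul_pure !mul1r.
- by rewrite mulDr hu hv.
Qed.
HB.instance Definition _ :=
  GRing.Zmodule_isComPzRing.Build tens mulA mulC mul1l mulDl.

Lemma pureM a r a' r' : pure a r * pure a' r' = pure (a * a') (r * r').
Proof. exact: mul_pure. Qed.

Lemma pure0r r : pure 0 r = 0.
Proof. by apply: (addIr (pure 0 r)); rewrite add0r -pureDl addr0. Qed.

(* a |-> a (x) 1 *)
Definition tens_inl (a : A) : tens := pure a 1.
Lemma tens_inl_nmod : nmod_morphism tens_inl.
Proof. by split=> [|x y]; [exact: pure0r | exact: pureDl]. Qed.
Lemma tens_inl_monoid : monoid_morphism tens_inl.
Proof. by split=> // x y; rewrite /tens_inl pureM mulr1. Qed.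
HB.instance Definition _ :=
  GRing.isNmodMorphism.Build A tens tens_inl tens_inl_nmod.
HB.instance Definition _ :=
  GRing.isMonoidMorphism.Build A tens tens_inl tens_inl_monoid.
End TensorRing.

(* tau : a (x) r |-> a (x) r^q *)
Section Frobenius.
Variables (F : finFieldType) (A R : comPzRingType).
Variables (iA : {rmorphism F -> A}) (iR : {rmorphism F -> R}).

Lemma frobD (x y : R) : (x + y) ^+ #|F| = x ^+ #|F| + y ^+ #|F|.
Proof.
have [R0|R1] := eqVneq (1 : R) 0.
  by rewrite -[LHS]mulr1 -[RHS]mulr1 R0 !mulr0.
pose nz := GRing.PzSemiRing_isNonZero.Build R R1.
pose R' : comNzRingType := HB.pack R nz.
have [p p_pr pF] := finPcharP F.
have pR : p \in [pchar R'] by exact: (rmorph_pchar (iR : {rmorphism F -> R'})).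
apply: (@exprDn_pchar R'); rewrite (eq_pnat _ (pcharf_eq pR)).
by have := pprimeChar_pgroup pF; rewrite /pgroup cardsT.
Qed.

Let g (a : A) (r : R) : tens iA iR := pure iA iR a (r ^+ #|F|).
Let gDl r : {morph g^~ r : a b / a + b}.
Proof. by move=> a b; rewrite /g pureDl. Qed.
Let gDr a : {morph g a : r s / r + s}.
Proof. by move=> r s; rewrite /g frobD pureDr. Qed.
Let g_bal a c r : g (a * iA c) r = g a (iR c * r).
Proof. by rewrite /g pure_bal exprMn -rmorphXn expf_card. Qed.

Definition frob : tens iA iR -> tens iA iR :=
  tens_lift (fun a r => pure iA iR a (r ^+ #|F|)).

Lemma frob_pure a r : frob (pure iA iR a r) = pure iA iR a (r ^+ #|F|).
Proof. exact: (tens_lift_pure gDl gDr g_bal). Qed.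

Lemma frob_nmod : nmod_morphism frob.
Proof.
split; first exact: (tens_lift0 gDl gDr g_bal).
exact: (tens_liftD gDl gDr g_bal).
Qed.
HB.instance Definition _ :=
  GRing.isNmodMorphism.Build (tens iA iR) (tens iA iR) frob frob_nmod.

Lemma frob_monoid : monoid_morphism frob.
Proof.
split; first by rewrite [LHS]frob_pure expr1n.
move=> x y; elim/tens_ind: x => [|a r|u v hu hv].
- by rewrite mul0r raddf0 mul0r.
- elim/tens_ind: y => [|b s|u v hu hv]; first by rewrite mulr0 raddf0 mulr0.
    by rewrite pureM !frob_pure pureM exprMn.
  by rewrite mulrDr !raddfD /= mulrDr hu hv.
- by rewrite mulrDl !raddfD /= mulrDl hu hv.
Qed.
HB.instance Definition _ :=
  GRing.isMonoidMorphism.Build (tens iA iR) (tens iA iR) frob frob_monoid.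

Lemma frob_inl a : frob (tens_inl iA iR a) = tens_inl iA iR a.
Proof. by rewrite /tens_inl frob_pure expr1n. Qed.
End Frobenius.
Arguments frob {F A R} iA iR x.

(* A geometrically irreducible smooth projective curve over the finite (hence
   perfect) field F is given by its function field: a finitely generated field
   extension of transcendence degree 1 in which F is algebraically closed.
   The closed points of the curve are the places of the function field, i.e.
   the nontrivial valuation rings containing F, the valuation ring of a point
   being its local ring; the sections over an open subset are the functions
   that belong to the local rings of all its closed points. *)
Record curve (F : finFieldType) := Curve {
  curve_field : fieldType;
  curve_const : {rmorphism F -> curve_field};
  curve_trdeg1 : exists t : curve_field, ~ algebraicOver curve_const t /\
    exists n (e : 'I_n -> curve_field), forall x,
      exists (d : {poly F}) (p : 'I_n -> {poly F}), d != 0 /\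
        (map_poly curve_const d).[t] * x =
          \sum_i (map_poly curve_const (p i)).[t] * e i;
  curve_geom_irred : forall x : curve_field,
    algebraicOver curve_const x -> exists c, x = curve_const c }.

Record closed_point (F : finFieldType) (C : curve F) := ClosedPoint {
  local_ring : set (curve_field C);
  local_ring_const : forall c, local_ring (curve_const C c);
  local_ringB : forall x y, local_ring x -> local_ring y -> local_ring (x - y);
  local_ringM : forall x y, local_ring x -> local_ring y -> local_ring (x * y);
  local_ring_val : forall x, local_ring x \/ local_ring x^-1;
  local_ring_proper : exists x, ~ local_ring x }.

Section AffineRing.
Variables (F : finFieldType) (C : curve F) (infty : closed_point C).
Local Notation K := (curve_field C).

(* A = Gamma(C \ {infty}, O_C) *)
Definition regular_off : {pred K} :=
  fun x => `[< forall P : closed_point C,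
                 local_ring P <> local_ring infty -> local_ring P x >].

Lemma regular_offP (x : K) : reflect (forall P : closed_point C,
    local_ring P <> local_ring infty -> local_ring P x) (x \in regular_off).
Proof. exact: asboolP. Qed.

Lemma regular_off_const c : curve_const C c \in regular_off.
Proof. by apply/regular_offP => P _; apply: local_ring_const. Qed.

Lemma regular_off_subring : subring_closed regular_off.
Proof.
split=> [|x y /regular_offP hx /regular_offP hy|x y /regular_offP hx /regular_offP hy].
- by rewrite -(rmorph1 (curve_const C)) regular_off_const.
- by apply/regular_offP => P ne; apply: local_ringB; [apply: hx|apply: hy].
- by apply/regular_offP => P ne; apply: local_ringM; [apply: hx|apply: hy].
Qed.
HB.instance Definition _ :=
  GRing.isSubringClosed.Build K regular_off regular_off_subring.

Record affine_ring := AffineRing {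
  affine_val : K; affine_valP : affine_val \in regular_off }.
HB.instance Definition _ := [isSub for affine_val].
HB.instance Definition _ := [Choice of affine_ring by <:].
HB.instance Definition _ := [SubChoice_isSubComNzRing of affine_ring by <:].

Definition affine_const (c : F) : affine_ring := AffineRing (regular_off_const c).
Lemma affine_const_nmod : nmod_morphism affine_const.
Proof.
by split=> [|x y]; apply: val_inj; rewrite ?(raddf0 val) ?(raddfD val) /= ?rmorph0 ?rmorphD.
Qed.
Lemma affine_const_monoid : monoid_morphism affine_const.
Proof.
by split=> [|x y]; apply: val_inj; rewrite ?(rmorph1 val) ?(rmorphM val) /= ?rmorph1 ?rmorphM.
Qed.
HB.instance Definition _ :=
  GRing.isNmodMorphism.Build F affine_ring affine_const affine_const_nmod.
HB.instance Definition _ :=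
  GRing.isMonoidMorphism.Build F affine_ring affine_const affine_const_monoid.
End AffineRing.

Definition noetherian (R : comPzRingType) :=
  forall I : set R, I 0 -> (forall a x y, I x -> I y -> I (a * x + y)) ->
    exists n (g : 'I_n -> R), forall x,
      I x <-> exists c : 'I_n -> R, x = \sum_i c i * g i.

Section AMotive.
Variables (F : finFieldType) (C : curve F) (infty : closed_point C).
Local Notation A := (affine_ring infty).
Variables (R : comPzRingType) (iR : {rmorphism F -> R}) (kappa : {rmorphism A -> R}).

Definition amot_base : motive_base := {|
  mb_A := A;
  mb_S := tens (affine_const infty) iR;
  mb_in := tens_inl (affine_const infty) iR;
  mb_tau := frob (affine_const infty) iR;
  mb_tau_in := frob_inl (affine_const infty) iR;
  mb_gen := [set x | exists a : A, (forall c, a <> affine_const infty c) /\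
    x = pure (affine_const infty) iR a 1 - pure (affine_const infty) iR 1 (kappa a)]
|}.

Definition amotive : Type := motive amot_base.
End AMotive.

(* Main.v *)
(** A class in Ext^1(N, M) has a connecting map: for an extension E of N by M
    and n in N fixed by tau, lift n to e in E; then (id - tau) e comes from
    M[j^-1], uniquely up to (id - tau) M.  For N = 1 and n = 1, this element
    determines E: since tau-semilinear data on 1 is determined by the value at
    1, the choice of e is the same as a morphism from the extension
    (M (+) S, (tau_M, m . 1; 0, 1)) to E, S = A (x) R.  All claims on Ext^1
    follow by chasing the connecting map through morphisms of extensions.

    All this uses that short exact sequences of motives split as sequences of
    S-modules, so that ( )[j^-1] is exact on them: a locally free module of
    finite rank is projective, as one sees by patching the local bases into a
    finite dual basis.

    For i >= 2 write an i-extension as the splice of an extension X of 1 by K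
    with a sequence whose first surjection is p : E ->> K.  Lifting the element
    of K[j^-1] that classifies X to E[j^-1] shows that X is a pushout along p;
    moving p to the other factor makes that factor split. *)

Require Import Defs.
From HB Require Import structures.
From mathcomp Require Import all_boot all_algebra.
From mathcomp Require Import boolp classical_sets.
From mathcomp Require Import ring zify.
From Stdlib Require Import Relation_Operators.

Set Implicit Arguments.
Unset Strict Implicit.
Unset Printing Implicit Defensive.

Import GRing.Theory.
Local Open Scope ring_scope.

(** * Vanishing in a localised module *)

Section TrivialExtension.
Variables (S : comPzRingType) (M : lmodType S).

Definition triv_ext : Type := (S * M)%type.
HB.instance Definition _ := GRing.Zmodule.on triv_ext.

Let mul (x y : triv_ext) : triv_ext := (x.1 * y.1, x.1 *: y.2 + y.1 *: x.2).
Let mulA : associative mul.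
Proof.
move=> x y z; congr pair => /=; first by rewrite mulrA.
by rewrite !scalerDr !scalerA addrA [z.1 * x.1]mulrC [z.1 * y.1]mulrC.
Qed.
Let mulC : commutative mul.
Proof. by move=> x y; congr pair => /=; rewrite 1?mulrC 1?addrC. Qed.
Let mul1 : left_id (1, 0) mul.
Proof. by move=> [s m]; congr pair; rewrite /= ?mul1r // scale1r scaler0 addr0. Qed.
Let mulD : left_distributive mul +%R.
Proof.
move=> x y z; congr pair => /=; first by rewrite mulrDl.
by rewrite scalerDl scalerDr addrACA.
Qed.
HB.instance Definition _ :=
  GRing.Zmodule_isComPzRing.Build triv_ext mulA mulC mul1 mulD.

Definition triv_in (s : S) : triv_ext := (s, 0).
Lemma triv_in_zmod : zmod_morphism triv_in.
Proof. by move=> x y; congr pair; rewrite /= subr0. Qed.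
Lemma triv_in_monoid : monoid_morphism triv_in.
Proof. by split=> // x y; congr pair; rewrite /= !scaler0 addr0. Qed.
HB.instance Definition _ :=
  GRing.isZmodMorphism.Build S triv_ext triv_in triv_in_zmod.
HB.instance Definition _ :=
  GRing.isMonoidMorphism.Build S triv_ext triv_in triv_in_monoid.

Variable U : mulset S.
Let U'1 : exists2 u, U u & (1 : triv_ext) = triv_in u.
Proof. by exists 1 => //; apply: mulset1. Qed.
Let U'M (s t : triv_ext) : (exists2 u, U u & s = triv_in u) ->
  (exists2 u, U u & t = triv_in u) -> exists2 u, U u & s * t = triv_in u.
Proof.
move=> [u Uu ->] [v Uv ->]; exists (u * v); first exact: mulsetM.
by rewrite rmorphM.
Qed.
Definition triv_mulset : mulset triv_ext := MulSet U'1 U'M.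

(* The S-module localisation of M sits inside the ring localisation of its
   trivial square-zero extension. *)
Lemma loc_tens_eq0 (m : M) :
  bc_tens (loc_in U) 1 m = 0 -> exists2 u, U u & u *: m = 0.
Proof.
(* Elements of [U] become invertible in the localised trivial extension, so [loc U] maps to it by
   [h], and [g] carries the tensor of [b] and [m] to [h b] times the class of [(0, m)]. *)
have inv t : U t -> exists b, b * (loc_in triv_mulset \o triv_in) t = 1.
  move=> Ut; have Ut' : triv_mulset (triv_in t) by exists t.
  by exists (Defs.frac 1 (mk_denom Ut')); exact: (loc_in_unit (mk_denom Ut')).
have [h hE] := loc_lift_ex inv.
pose g b (m : M) := h b * loc_in triv_mulset ((0, m) : triv_ext).
have gDl n : {morph g^~ n : b b' / b + b'}.
  by move=> b b'; rewrite /g rmorphD mulrDl.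
have gDr b : {morph g b : n n' / n + n'}.
  by move=> n n'; rewrite /g -mulrDr -rmorphD; congr (_ * loc_in _ _);
    congr pair; rewrite /= addr0.
have gbal b c n : g (b * loc_in U c) n = g b (c *: n).
  rewrite /g rmorphM hE /= -mulrA -rmorphM.
  by congr (_ * loc_in _ _); congr pair; rewrite /= ?mulr0 // scale0r addr0.
move=> /(congr1 (bc_lift g)); rewrite bc_lift_tens // bc_lift0 // /g rmorph1 mul1r.
move=> /fracE[_ [[u Uu ->]]]; rewrite mk_denomE mulr1 mul0r mulr0 => -[_ e].
by exists u => //; move: e => /=; rewrite scale0r addr0.
Qed.
End TrivialExtension.

(** * Clearing denominators *)

Section ClearDenominators.
Variables (S : comPzRingType) (U : mulset S).

Lemma mulset_prod (G : finType) (u : G -> S) :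
  (forall g, U (u g)) -> U (\prod_g u g).
Proof. by move=> Uu; elim/big_ind: _ => // [|x y]; [apply: mulset1|apply: mulsetM]. Qed.

(** As [P g] passes to multiples, the product of the individual witnesses serves all [g] at once. *)
Lemma mulset_uniform (G : finType) (P : G -> S -> Prop) :
  (forall g s t, P g t -> P g (s * t)) ->
  (forall g, exists2 u, U u & P g u) -> exists2 u, U u & forall g, P g u.
Proof.
move=> PM /(_ _)/cid2 ex; exists (\prod_g s2val (ex g)) => [|g].
  by apply: mulset_prod => g; apply: (s2valP (ex g)).
by rewrite (bigD1 g) //= mulrC; apply: PM; apply: (s2valP' (ex g)).
Qed.

Lemma loc_clear (b : loc U) :
  exists2 u, U u & exists s, loc_in U u * b = loc_in U s.
Proof.
have [s [t ->]] := frac_ex b; exists (dval t); first exact: denomP.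
by exists s; rewrite frac_mul mulrC -mulrA loc_in_unit mulr1.
Qed.

Lemma loc_clearZ (V : lmodType (loc U)) u (v : V) :
  U u -> loc_in U u *: v = 0 -> v = 0.
Proof.
move=> Uu e; rewrite -[v]scale1r -(loc_in_unit (mk_denom Uu)) -scalerA.
by rewrite mk_denomE e scaler0.
Qed.

Lemma bc_clear (M : lmodType S) (x : bc (loc_in U) M) :
  exists2 u, U u & exists m, loc_in U u *: x = bc_tens (loc_in U) 1 m.
Proof.
elim/bc_ind: x => [|b m|x y [u Uu [m e]] [v Uv [n e']]].
- exists 1; first exact: mulset1.
  exists 0; rewrite scaler0.
  by apply: (addIr (bc_tens (loc_in U) 1 0)); rewrite -bc_tensDr !addr0 add0r.
- have [u Uu [s e]] := loc_clear b; exists u => //.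
  by exists (s *: m); rewrite bc_tensZ e -bc_tens_bal mul1r.
- exists (u * v); first exact: mulsetM.
  exists (v *: m + u *: n); rewrite scalerDr bc_tensDr -!bc_tens_bal !mul1r.
  rewrite rmorphM {1}mulrC -!scalerA e e' !bc_tensZ !mulr1.
  by [].
Qed.
End ClearDenominators.

(** * Local bases made of elements of the module itself *)

Section LocalBasis.
Variables (S : comPzRingType) (U : mulset S) (M : lmodType S) (r : nat).
Variable phi : {linear bc (loc_in U) M -> 'rV[loc U]_r}.
Hypothesis phi_bij : bijective phi.

(** The [k j] are the preimages of the standard basis with denominators cleared. Spanning and
    independence descend to [M] up to factors from [U], by [loc_tens_eq0]. *)
Lemma free_loc_basis : exists k : 'I_r -> M,
  (forall m, exists2 u, U u & exists v : 'I_r -> S, u *: m = \sum_j v j *: k j) /\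
  (forall v : 'I_r -> S, \sum_j v j *: k j = 0 ->
     exists2 u, U u & forall j, u * v j = 0).
Proof.
have [psi phiK psiK] := phi_bij.
have /(_ _)/cid2 ex := fun j => bc_clear (psi (delta_mx 0 j)).
pose t j := s2val (ex j).
have Ut j : U (t j) by exact: (s2valP (ex j)).
have /(_ _)/cid exk := fun j => s2valP' (ex j).
pose k j : M := sval (exk j).
have phik j : phi (bc_tens (loc_in U) 1 (k j)) = loc_in U (t j) *: delta_mx 0 j.
  by rewrite -(svalP (exk j)) linearZ /= psiK.
have sumE (b : 'I_r -> loc U) :
    phi (\sum_j bc_tens (loc_in U) (b j) (k j)) = \row_j (b j * loc_in U (t j)).
  rewrite linear_sum /=; apply/rowP => j; rewrite summxE (bigD1 j) //= big1.
    by rewrite -[b j]mulr1 -bc_tensZ linearZ /= phik !mxE !eqxx !mulr1 addr0.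
  move=> i ij; rewrite -[b i]mulr1 -bc_tensZ linearZ /= phik !mxE eqxx /=.
  by rewrite eq_sym (negbTE ij) !mulr0.
have tens_sum (v : 'I_r -> S) : bc_tens (loc_in U) 1 (\sum_j v j *: k j) =
    \sum_j bc_tens (loc_in U) (loc_in U (v j)) (k j).
  rewrite -[LHS]/(bc_in (loc_in U) _) linear_sum; apply: eq_bigr => j _.
  by rewrite -[LHS]/(bc_tens _ 1 (v j *: k j)) -bc_tens_bal mul1r.
exists k; split=> [m|v e].
  pose w := phi (bc_tens (loc_in U) 1 m).
  (* Division by [t j] makes up for [k j] being [t j] times a basis vector. *)
  pose b j := w 0 j * Defs.frac 1 (mk_denom (Ut j)).
  have mE : bc_tens (loc_in U) 1 m = \sum_j bc_tens (loc_in U) (b j) (k j).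
    apply: (can_inj phiK); rewrite sumE; apply/rowP => j; rewrite mxE /b -mulrA.
    by rewrite (loc_in_unit (mk_denom (Ut j))) mulr1.
  have [u Uu bu] : exists2 u, U u & forall j, exists s, loc_in U u * b j = loc_in U s.
    apply: mulset_uniform => [j s t' [s' e]|j]; last exact: loc_clear.
    by exists (s * s'); rewrite !rmorphM -mulrA e.
  pose v j := sval (cid (bu j)).
  have /loc_tens_eq0[u' Uu' e] : bc_tens (loc_in U) 1 (u *: m - \sum_j v j *: k j) = 0.
    rewrite -[LHS]/(bc_in (loc_in U) _) linearB /=; apply/eqP; rewrite subr_eq0.
    apply/eqP; rewrite /bc_in tens_sum -bc_tens_bal mul1r /= -[loc_in U u]mulr1.
    rewrite -bc_tensZ mE scaler_sumr; apply: eq_bigr => j _.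
    by rewrite bc_tensZ (svalP (cid (bu j))).
  exists (u' * u); first exact: mulsetM.
  exists (fun j => u' * v j); rewrite -scalerA.
  move/eqP: e; rewrite scalerBr subr_eq0 => /eqP->; rewrite scaler_sumr.
  by apply: eq_bigr => j _; rewrite scalerA.
apply: (mulset_uniform (P := fun j u => u * v j = 0)) => [j s t' e'|j].
  by rewrite -mulrA e' mulr0.
have : phi (bc_tens (loc_in U) 1 (\sum_j v j *: k j)) 0 j = 0.
  by rewrite e -[bc_tens _ _ _]/(bc_in (loc_in U) _) linear0 linear0 mxE.
rewrite tens_sum sumE mxE -rmorphM => /fracE[u [Uu]].
rewrite mk_denomE mulr1 mul0r mulr0 => e'.
by exists (u * t j); [apply: mulsetM|rewrite -mulrA [t j * _]mulrC].
Qed.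
End LocalBasis.

(** * Locally free modules of finite rank are projective *)

Section Projective.
Variable S : comPzRingType.

Definition ideal_set (J : S -> Prop) :=
  J 0 /\ forall a x y, J x -> J y -> J (a * x + y).

(** Every term of the binomial expansion of exponent [n + m] contains [a ^+ n] or [b ^+ m]. *)
Lemma ideal_add_exp (J : S -> Prop) a b : ideal_set J ->
  (exists n, J (a ^+ n)) -> (exists n, J (b ^+ n)) -> exists n, J ((a + b) ^+ n).
Proof.
move=> [J0 JD] [n Jn] [m Jm]; exists (n + m)%N; rewrite exprDn.
have JM x y : J y -> J (x * y) by move=> Jy; rewrite -[x * y]addr0; apply: JD.
apply: (big_ind J) => // [x y Jx Jy|i _]; first by rewrite -[x]mul1r; apply: JD.
rewrite -mulr_natl; apply: (JM); have [le_mi|lt_im] := leqP m i.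
  by rewrite -(subnK le_mi) exprD; do 2 apply: (JM).
have le_ni : (n <= n + m - i)%N by rewrite leq_subRL; [lia|lia].
by rewrite -(subnK le_ni) exprD mulrC; do 2 apply: (JM).
Qed.

(** All [f i] lie in the radical of [J], hence so does 1. This is the local-to-global principle:
    take for [J] the scalars [s] for which a claim holds after multiplication by [s]. *)
Lemma cover_ideal (I : finType) (f c : I -> S) (J : S -> Prop) :
  \sum_i c i * f i = 1 -> ideal_set J ->
  (forall i, exists2 u, powers (f i) u & J u) -> J 1.
Proof.
move=> e iJ Jf; have [J0 JD] := iJ.
have JM x y : J y -> J (x * y) by move=> Jy; rewrite -[x * y]addr0; apply: JD.
suff [n] : exists n, J (1 ^+ n) by rewrite expr1n.
rewrite -e; apply: (big_ind (fun x => exists n, J (x ^+ n))).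
- by exists 1%N; rewrite expr1.
- by move=> x y; apply: ideal_add_exp.
- move=> i _; have [_ [n ->] Jn] := Jf i; exists n.
  by rewrite exprMn; apply: JM.
Qed.

Lemma sum_delta (V : lmodType S) (G : finType) (h : G) (v : G -> V) :
  \sum_g (g == h)%:R *: v g = v h.
Proof.
rewrite (bigD1 h) //= eqxx scale1r big1 ?addr0 // => g /negbTE->.
by rewrite scale0r.
Qed.

Lemma pair_sum (V : zmodType) (I J : finType) (F : I * J -> V) :
  \sum_g F g = \sum_i \sum_j F (i, j).
Proof. by rewrite pair_bigA; apply: eq_bigr => -[]. Qed.

(** The local bases together generate [M], and their relations are finitely generated. Hence one
    scalar per chart makes the local coordinates well defined on [M], and a partition of unity glues
    these coordinates. *)
Lemma locally_free_dual_basis (M : lmodType S) : locally_free M ->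
  exists (G : finType) (k : G -> M) (theta : G -> {linear M -> S^o}),
    forall m, m = \sum_g (theta g m : S) *: k g.
Proof.
move=> [r [I [f [c [cf1 free]]]]].
have /(_ _)/cid exk : forall i, exists k : 'I_r -> M,
    (forall m, exists2 u, powers (f i) u &
       exists v : 'I_r -> S, u *: m = \sum_j v j *: k j) /\
    (forall v : 'I_r -> S, \sum_j v j *: k j = 0 ->
       exists2 u, powers (f i) u & forall j, u * v j = 0).
  by move=> i; have [phi] := free i; apply: free_loc_basis.
pose G : finType := (I * 'I_r)%type.
pose k (g : G) : M := sval (exk g.1) g.2.
have loc_span i m : exists2 u, powers (f i) u &
    exists v : 'I_r -> S, u *: m = \sum_j v j *: k (i, j).
  exact: (proj1 (svalP (exk i))).
have loc_free i (v : 'I_r -> S) : \sum_j v j *: k (i, j) = 0 ->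
    exists2 u, powers (f i) u & forall j, u * v j = 0.
  exact: (proj2 (svalP (exk i))).
have gen m : exists a : G -> S, m = \sum_g a g *: k g.
  have [] := cover_ideal (J := fun s => exists a : G -> S,
    s *: m = \sum_g a g *: k g) cf1.
  - split=> [|s x y [a ea] [b eb]].
      by exists (fun=> 0); rewrite scale0r big1 // => g _; rewrite scale0r.
    exists (fun g => s * a g + b g); rewrite scalerDl -scalerA ea eb scaler_sumr.
    by rewrite -big_split; apply: eq_bigr => g _; rewrite scalerDl scalerA.
  - move=> i; have [u Uu [v e]] := loc_span i m; exists u => //.
    exists (fun g => (g.1 == i)%:R * v g.2); rewrite e.
    rewrite pair_sum /=.
    rewrite (bigD1 i) //= [X in _ = _ + X]big1 => [|i' /negbTE->].
      by rewrite addr0 eqxx; apply: eq_bigr => j _; rewrite mul1r.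
    by apply: big1 => j _; rewrite mul0r scale0r.
  - by move=> a; rewrite scale1r; exists a.
have /(_ _)/cid2 exu : forall i, exists2 u, powers (f i) u &
    forall g, exists v : 'I_r -> S, u *: k g = \sum_j v j *: k (i, j).
  move=> i; apply: mulset_uniform => [g s t [v e]|g]; last exact: loc_span.
  exists (fun j => s * v j); rewrite -scalerA e scaler_sumr.
  by apply: eq_bigr => j _; rewrite scalerA.
pose u i := s2val (exu i).
have Uu i : powers (f i) (u i) by exact: (s2valP (exu i)).
have /(_ _ _)/cid exv := fun i => s2valP' (exu i).
pose v i g : 'I_r -> S := sval (exv i g).
have vE i g : u i *: k g = \sum_j v i g j *: k (i, j) by exact: (svalP (exv i g)).
(* Coordinates in chart [i] of [u i] times the combination of the [k g] with coefficients [a]. *)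
pose V i (a : G -> S) j := \sum_g a g * v i g j.
have VE i a : \sum_j V i a j *: k (i, j) = u i *: \sum_g a g *: k g.
  rewrite scaler_sumr; under eq_bigr do rewrite scaler_suml.
  rewrite exchange_big; apply: eq_bigr => g _ /=.
  rewrite scalerA mulrC -scalerA vE scaler_sumr.
  by apply: eq_bigr => j _; rewrite scalerA.
(* For [p = (i, h)], the coefficients of the relation that writes [u i *: k h] in the local basis of
   chart [i]. *)
pose rho (p : I * G) (g : G) : S :=
  u p.1 * (g == p.2)%:R - (g.1 == p.1)%:R * v p.1 p.2 g.2.
have rho_sum (W : lmodType S) (w : G -> W) i h :
    \sum_g rho (i, h) g *: w g = u i *: w h - \sum_j v i h j *: w (i, j).
  under eq_bigr do rewrite /rho /= scalerBl -scalerA.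
  rewrite sumrB -scaler_sumr sum_delta; congr (_ - _).
  rewrite pair_sum /=.
  rewrite (bigD1 i) //= [X in _ + X]big1 => [|i' /negbTE->].
    by rewrite addr0 eqxx; apply: eq_bigr => j _; rewrite mul1r.
  by apply: big1 => j _; rewrite mul0r scale0r.
(* The [rho p] generate all relations: in chart [i] the coordinates [V i a] vanish up to a factor
   [u'], so [u' * u i] times [a] is the combination of the [rho (i, h)] with coefficients
   [u' * a h]. *)
have rel_gen (a : G -> S) : \sum_g a g *: k g = 0 ->
    exists b : I * G -> S, forall g, a g = \sum_p b p * rho p g.
  move=> a0; have [] := cover_ideal (J := fun s => exists b : I * G -> S,
    forall g, s * a g = \sum_p b p * rho p g) cf1.
  - split=> [|s x y [b eb] [b' eb']].
      by exists (fun=> 0) => g; rewrite mul0r big1 // => p _; rewrite mul0r.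
    exists (fun p => s * b p + b' p) => g; rewrite mulrDl -mulrA eb eb' mulr_sumr.
    by rewrite -big_split; apply: eq_bigr => p _; rewrite mulrDl mulrA.
  - move=> i; have [|u' Uu' e] := loc_free i (V i a); first by rewrite VE a0 scaler0.
    exists (u' * u i); first exact: mulsetM.
    exists (fun p => (p.1 == i)%:R * (u' * a p.2)) => g.
    rewrite pair_sum /=.
    rewrite (bigD1 i) //= [X in _ = _ + X]big1 => [|i' /negbTE->]; last first.
      by apply: big1 => h _; rewrite !mul0r.
    rewrite addr0 eqxx; under eq_bigr do rewrite mul1r /rho /= mulrBr.
    rewrite sumrB (bigD1 g) //= eqxx [X in _ + X - _]big1 => [|h]; last first.
      by rewrite eq_sym => /negbTE->; rewrite !mulr0.
    rewrite [X in _ - X](_ : _ = (g.1 == i)%:R * (u' * V i a g.2)); last first.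
      rewrite /V !mulr_sumr; apply: eq_bigr => h _; ring.
    by rewrite e mulr0 addr0 subr0 mulr1; ring.
  - by move=> b e; exists b => g; rewrite -e mul1r.
(* There are finitely many [rho p], so one [w] in the powers of [f i] kills their coordinates, and
   with them those of every relation. *)
have /(_ _)/cid2 exw : forall i, exists2 w, powers (f i) w &
    forall p j, w * V i (rho p) j = 0.
  move=> i; apply: (mulset_uniform (P := fun p w => forall j, w * V i (rho p) j = 0)).
    by move=> p s t e j; rewrite -mulrA e mulr0.
  move=> [i' h]; apply: loc_free; rewrite VE rho_sum vE.
  by rewrite subrr scaler0.
pose w i := s2val (exw i).
have Uw i : powers (f i) (w i) by exact: (s2valP (exw i)).
have wV i a : \sum_g a g *: k g = 0 -> forall j, w i * V i a j = 0.
  move=> /rel_gen[b e] j; rewrite /V.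
  under eq_bigr do rewrite e mulr_suml.
  rewrite exchange_big mulr_sumr big1 // => p _ /=.
  under eq_bigr do rewrite -mulrA.
  by rewrite -mulr_sumr mulrCA [w i * _](s2valP' (exw i)) mulr0.
have /(_ _)/cid exa := gen.
pose a m : G -> S := sval (exa m).
have aE m : \sum_g a m g *: k g = m by rewrite -(svalP (exa m)).
(* The choice of coefficients [a m] is not linear in [m], but two choices differ by a relation,
   which [w i] kills; so [th i j] is linear. *)
pose th i j m : S^o := w i * V i (a m) j.
have th_lin i j : linear (th i j).
  move=> s x y; suff: (th i j (s *: x + y) : S) - (s * th i j x + th i j y) = 0.
    by move/eqP; rewrite subr_eq0 => /eqP.
  rewrite -[RHS](wV i (fun g => a (s *: x + y) g - (s * a x g + a y g)) _ j).
    rewrite /th /V; under [in RHS]eq_bigr do rewrite mulrBl mulrDl -mulrA.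
    by rewrite sumrB big_split -mulr_sumr /=; ring.
  under eq_bigr do rewrite scalerBl scalerDl -scalerA.
  by rewrite sumrB big_split -scaler_sumr /= !aE subrr.
pose thl i j : {linear M -> S^o} :=
  HB.pack (th i j) (GRing.isLinear.Build S M S^o _ (th i j) (th_lin i j)).
have thE i m : \sum_j (thl i j m : S) *: k (i, j) = (w i * u i) *: m.
  rewrite -[m in RHS]aE -scalerA -VE scaler_sumr.
  by apply: eq_bigr => j _; rewrite scalerA.
(* The scalars [w i * u i] generate the unit ideal; the [d i] are the weights of the gluing. *)
have [] := cover_ideal (J := fun s => exists d : I -> S,
  s = \sum_i d i * (w i * u i)) cf1.
- split=> [|s x y [d ->] [d' ->]].
    by exists (fun=> 0); rewrite big1 // => i _; rewrite mul0r.
  exists (fun i => s * d i + d' i); rewrite mulr_sumr -big_split.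
  by apply: eq_bigr => i _; rewrite mulrDl mulrA.
- move=> i; exists (w i * u i); first exact: mulsetM.
  exists (fun i' => (i' == i)%:R); rewrite (bigD1 i) //= eqxx mul1r big1 ?addr0 //.
  by move=> i' /negbTE->; rewrite mul0r.
move=> d d1; exists G, k, (fun g => d g.1 \*: thl g.1 g.2) => m.
rewrite pair_sum /=.
rewrite -[LHS]scale1r d1 scaler_suml; apply: eq_bigr => i _.
by rewrite -scalerA -thE scaler_sumr; apply: eq_bigr => j _; rewrite scalerA.
Qed.

Lemma locally_free_lift (N E : lmodType S) (p : {linear E -> N}) :
  locally_free N -> (forall n, exists e, p e = n) ->
  exists s : {linear N -> E}, forall n, p (s n) = n.
Proof.
move=> /locally_free_dual_basis[G [k [theta kE]]] /(_ _)/cid lift.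
pose s n : E := \sum_g (theta g n : S) *: sval (lift (k g)).
have s_lin : linear s.
  move=> a x y; rewrite /s scaler_sumr -big_split; apply: eq_bigr => g _ /=.
  by rewrite linearP scalerDl scalerA.
pose sl : {linear N -> E} := HB.pack s (GRing.isLinear.Build S N E _ s s_lin).
exists sl => n /=.
rewrite {2}[n]kE linear_sum; apply: eq_bigr => g _.
by rewrite linearZ /= (svalP (lift (k g))).
Qed.
End Projective.

(** * Linear maps on modules with j inverted *)

Section JinvMaps.
Variable B : motive_base.
Local Notation S := (mb_S B).
Implicit Types M N : lmodType S.

Lemma inv_regularZ M (s : S) (x : jinv M) :
  regular_elements S s -> s *: x = 0 -> x = 0.
Proof.
have v0 : inv_val (0 : jinv M) = 0 by exact: (raddf0 val).
move=> reg_s /(congr1 (@inv_val _ _ _)); rewrite inv_valZ restrE v0 => e.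
apply: Defs.inv_inj; rewrite v0.
exact: (@loc_clearZ _ _ (bc (to_quot S) M) s (inv_val x) reg_s e).
Qed.

Lemma jmap_in M N (g : {linear M -> N}) m : jmap g (jin m) = jin (g m).
Proof. by apply: Defs.inv_inj; apply: bc_map_tens. Qed.

(** A regular multiple of any element of [jinv N] comes from [N], and regular elements act
    injectively on [jinv M]. *)
Lemma jinv_ext N M (u v : {linear jinv N -> jinv M}) :
  (forall n, u (jin n) = v (jin n)) -> u =1 v.
Proof.
move=> e x; have [t reg_t [n tx]] := bc_clear (inv_val x).
have {}tx : t *: x = jin n by apply: Defs.inv_inj; rewrite inv_valZ restrE tx.
apply/eqP; rewrite -subr_eq0; apply/eqP; apply: (inv_regularZ reg_t).
by rewrite scalerBr -!linearZ /= tx e subrr.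
Qed.

Lemma jinv_twist_ext N M (u v : {linear jinv (twist N) -> jinv M}) :
  (forall n, u (jin (bc_in (mb_tau B) n : twist N))
           = v (jin (bc_in (mb_tau B) n : twist N))) -> u =1 v.
Proof.
move=> e; apply: jinv_ext; elim/bc_ind => [|b n|x y hx hy].
- by rewrite !linear0.
- by rewrite -[b]mulr1 -bc_tensZ !linearZ /= e.
- by rewrite !linearD /= hx hy.
Qed.
End JinvMaps.

(** * The map id - tau *)

Section MotDiff.
Variable B : motive_base.
Local Notation S := (mb_S B).
Local Notation bcin x := (bc_in (mb_tau B) x).
Implicit Types M N : motive B.

Lemma mot_diff_nat M N (f : mhom M N) (x : M) :
  jmap f (mot_diff x) = mot_diff (f x : N).
Proof.
rewrite linearB /= mhomP jmap_in; congr (_ - mot_tau _).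
by rewrite /tjmap jmap_in; congr (jin _); apply: bc_map_tens.
Qed.

(** Converse of [mot_diff_nat]: a linear map on [jinv (twist M)] is determined by its values on the
    tensors of 1 with elements of [M]. *)
Lemma mot_diff_homP M N (f : {linear M -> N}) :
  (forall x : M, jmap f (mot_diff x) = mot_diff (f x : N)) ->
  forall y : jinv (twist M), jmap f (mot_tau y) = mot_tau (tjmap f y).
Proof.
move=> e; apply: (jinv_twist_ext (u := jmap f \o mot_tau) (v := mot_tau \o tjmap f)).
move=> x /=; have := e x; rewrite linearB /= jmap_in => /addrI/oppr_inj ->.
by rewrite /tjmap jmap_in; congr (mot_tau (jin _)); symmetry; apply: bc_map_tens.
Qed.

Lemma mot_diffD M (x y : M) :
  mot_diff (x + y : M) = (mot_diff x : jinv M) + mot_diff y.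
Proof. exact: (raddfD (@mot_diff B M)). Qed.

Lemma mot_diffB M (x y : M) :
  mot_diff (x - y : M) = (mot_diff x : jinv M) - mot_diff y.
Proof. exact: (raddfB (@mot_diff B M)). Qed.

Lemma mot_diff1 : mot_diff (1 : mot_unit B) = 0.
Proof.
apply/eqP; rewrite subr_eq0; apply/eqP; rewrite [RHS]jmap_in.
by congr (jin _); rewrite [RHS]bc_unit_tens rmorph1 mulr1.
Qed.

(** A twisted Leibniz rule, from the semilinearity of tau. *)
Lemma mot_diffZ M (s : S) (x : M) :
  mot_diff (s *: x : M) =
    (s - mb_tau B s) *: jin x + mb_tau B s *: (mot_diff x : jinv M).
Proof.
rewrite /mot_diff linearZ /=.
have -> : bcin (s *: x) = mb_tau B s *: (bcin x : twist M).
  by rewrite /bc_in -bc_tens_bal mul1r bc_tensZ mulr1.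
rewrite !linearZ /= [in RHS]scalerBr scalerBl.
by rewrite addrA subrK scalerN.
Qed.
End MotDiff.

(** * The connecting map of a short exact sequence *)

Section Cocycle.
Variable B : motive_base.
Local Notation S := (mb_S B).
Local Notation unit := (mot_unit B).
Implicit Types M N : motive B.

Lemma ses_surj_inj N M (E : ses N M) m : ses_surj E (ses_inj E m) = 0.
Proof. by apply/ses_exact; exists m. Qed.

(** The splitting is only S-linear and need not respect tau. This suffices for exactness after
    inverting j, as [jmap] is an additive functor on linear maps. *)
Lemma ses_split N M (E : ses N M) : exists (r : {linear ses_mid E -> M})
    (s : {linear N -> ses_mid E}),
  [/\ forall m, r (ses_inj E m) = m, forall n, ses_surj E (s n) = n
    & forall e, e = ses_inj E (r e) + s (ses_surj E e)].
Proof.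
have [s sK] := locally_free_lift (mot_locally_free N) (@ses_surjP _ _ _ E).
have ex e : exists m, ses_inj E m = e - s (ses_surj E e).
  by apply/ses_exact; rewrite linearB /= sK subrr.
pose r e := sval (cid (ex e)).
have rE e : ses_inj E (r e) = e - s (ses_surj E e) by apply: svalP (cid (ex e)).
have r_lin : linear r.
  move=> a x y; apply: (@ses_injP _ _ _ E); rewrite linearP !rE !linearP /=.
  by rewrite scalerDr addrACA.
pose rl : {linear ses_mid E -> M} :=
  HB.pack r (GRing.isLinear.Build S _ _ _ r r_lin).
exists rl, s; split=> // [m|e]; last by rewrite rE subrK.
by apply: (@ses_injP _ _ _ E); rewrite rE ses_surj_inj linear0 subr0.
Qed.

Lemma jmap_ses_inj N M (E : ses N M) : injective (jmap (ses_inj E)).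
Proof.
have [r [s [rK _ _]]] := ses_split E; apply: (can_inj (g := jmap r)) => x.
by rewrite (jmap_comp (hg := idfun)) ?jmap_id.
Qed.

Lemma jmap_ses_surj N M (E : ses N M) y : exists x, jmap (ses_surj E) x = y.
Proof.
have [r [s [_ sK _]]] := ses_split E; exists (jmap s y).
by rewrite (jmap_comp (hg := idfun)) ?jmap_id.
Qed.

Lemma jmap_ses_exact N M (E : ses N M) x : jmap (ses_surj E) x = 0 ->
  exists y, jmap (ses_inj E) y = x.
Proof.
have [r [s [_ _ e]]] := ses_split E => x0; exists (jmap r x).
rewrite (jmap_comp (hg := ses_inj E \o r)) //.
rewrite -[RHS](jmap_id (g := idfun)) //.
rewrite (jmapD (g := ses_inj E \o r) (h := s \o ses_surj E) (gh := idfun)) //.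
rewrite -(jmap_comp (g := ses_surj E) (h := s) (hg := s \o ses_surj E)) //.
by rewrite x0 linear0 addr0.
Qed.

(* The connecting map of the snake lemma, from the kernel of id - tau on N to
   the cokernel of id - tau on M, up to sign. *)
Definition cocycle N M (E : ses N M) (n : N) (m : jinv M) :=
  exists2 e, ses_surj E e = n & jmap (ses_inj E) m = - mot_diff (e : ses_mid E).

Lemma cocycle_exists N M (E : ses N M) (n : N) :
  mot_diff n = 0 -> exists m, cocycle E n m.
Proof.
have [e <-] := ses_surjP E n; rewrite -mot_diff_nat => e0.
have [|m me] := jmap_ses_exact (E := E) (x := - mot_diff (e : ses_mid E)).
  by rewrite linearN /= e0 oppr0.
by exists m, e.
Qed.

(** Two lifts of [n] differ by an element of [M]. *)
Lemma cocycle_unique N M (E : ses N M) (n : N) m m' :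
  cocycle E n m -> cocycle E n m' -> exists x : M, m' = m + mot_diff x.
Proof.
move=> [e en em] [e' en' em'].
have [x xe] : exists x, ses_inj E x = e - e'.
  by apply/ses_exact; rewrite linearB /= en en' subrr.
exists x; apply: (@jmap_ses_inj _ _ E).
by rewrite linearD /= mot_diff_nat em em' xe mot_diffB addrA addNr add0r.
Qed.

Lemma cocycle_shift N M (E : ses N M) (n : N) m (x : M) :
  cocycle E n m -> cocycle E n (m + mot_diff x).
Proof.
move=> [e en em]; exists (e - ses_inj E x).
  by rewrite linearB /= en ses_surj_inj subr0.
by rewrite linearD /= em mot_diff_nat mot_diffB [in RHS]opprB addrC.
Qed.

Lemma cocycle_mor N M N' M' (g : mhom N N') (f : mhom M M') E E' n m :
  ses_mor g f E E' -> cocycle E n m -> cocycle E' (g n) (jmap f m).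
Proof.
move=> [h [hi hp]] [e en em]; exists (h e); first by rewrite hp en.
rewrite (jmap_comp (hg := h \o ses_inj E)) => [|x /=]; last by rewrite hi.
rewrite -(jmap_comp (g := ses_inj E) (h := h) (hg := h \o ses_inj E)) //.
by rewrite em linearN /= mot_diff_nat.
Qed.

(** Here tau sends [(0, 1)] to [(m, 1)]; this is the reason for the sign in [cocycle]. *)
Lemma mot_diff_iota M (m : jinv M) :
  mot_diff ((0, 1 : S) : mot_ext (N := unit) (dot_one m)) = - jmap inll m.
Proof.
apply/oppr_inj; rewrite opprK opprB; apply/eqP; rewrite subr_eq; apply/eqP.
have e1 : tjmap sndl
      (jin (bc_in (mb_tau B) ((0, 1) : M * S^o) : twist (M * S^o)%type)) =
    jin (bc_in (mb_tau B) (1 : S^o) : twist S^o).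
  by rewrite /tjmap jmap_in; congr (jin _); apply: bc_map_tens.
have e0 : tjmap fstl
      (jin (bc_in (mb_tau B) ((0, 1) : M * S^o) : twist (M * S^o)%type)) =
    jin (bc_in (mb_tau B) (0 : M) : twist M).
  by rewrite /tjmap jmap_in; congr (jin _); apply: bc_map_tens.
apply: (@jmap_pair_inj B M S^o).
  apply: (etrans (@mot_ext_tau_fst B M unit (dot_one m) _)); rewrite e0 e1 [RHS]linearD.
  rewrite jmap_fst_inl jmap_in.
  have -> : bc_in (mb_tau B) (0 : M) = 0 :> twist M.
    exact: (raddf0 (@bc_in _ _ (mb_tau B) M)).
  rewrite !linear0 add0r addr0 /dot_one /= jmap_in.
  rewrite [twist_one B _]bc_unit_tens rmorph1 mulr1.
  by rewrite [LHS]inv_mul_in scale1r.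
apply: (etrans (@mot_ext_tau_snd B M unit (dot_one m) _)); rewrite e1 [RHS]linearD.
rewrite jmap_snd_inl add0r [RHS]jmap_in.
by apply: esym; apply: subr0_eq; exact: mot_diff1.
Qed.

Lemma cocycle_iota M (m : jinv M) : cocycle (ext_iota_ses m) (1 : unit) m.
Proof. by exists (0, 1 : S); rewrite // mot_diff_iota opprK. Qed.

(** Converse of [cocycle_mor] for extensions built by [ext_iota_ses]: the lift [e] prescribes the
    map [(x, s) |-> f x + s e], and the cocycle equation is its compatibility with tau at
    [(0, 1)]. *)
Lemma mor_cocycle N M M' (g : mhom unit N) (f : mhom M M') (E : ses N M') m :
  cocycle E (g (1 : S)) (jmap f m) -> ses_mor g f (ext_iota_ses m) E.
Proof.
move=> [e en em].
pose h (x : mot_ext (N := unit) (dot_one m)) : ses_mid E :=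
  ses_inj E (f x.1) + (x.2 : S) *: e.
have h_lin : linear h.
  by move=> a x y; rewrite /h /= !linearP scalerDr scalerDl -scalerA addrACA.
pose hl : {linear mot_ext (N := unit) (dot_one m) -> ses_mid E} :=
  HB.pack h (GRing.isLinear.Build S _ _ _ h h_lin).
have hlP : forall x, jmap hl (mot_tau x) = mot_tau (tjmap hl x).
  apply: mot_diff_homP => x.
  pose x1 : mot_ext (N := unit) (dot_one m) := (0, 1 : S).
  (* By the Leibniz rule it suffices to compare both sides on the image of [M] ([t1]) and at [x1]
     ([t2], [t3]). *)
  have xE : x = mot_ext_inl (N := unit) (dot_one m) x.1 + (x.2 : S) *: x1.
    case: x => x s; congr pair; rewrite /= ?scaler0 ?addr0 //.
    by rewrite add0r -[RHS]/(s * 1) mulr1.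
  have t2 : jmap hl (jin x1) = jin e.
    by rewrite jmap_in; congr (jin _); rewrite /= /h /= !linear0 add0r scale1r.
  have hinl y : jmap hl (jmap inll y) = jmap (ses_inj E) (jmap f y).
    rewrite (jmap_comp (g := inll) (h := hl) (hg := ses_inj E \o f))
      => [|z]; last first.
      by rewrite -[RHS]/(ses_inj E (f z) + 0 *: e) scale0r addr0.
    by rewrite (jmap_comp (hg := ses_inj E \o f)).
  have t1 y : jmap hl (mot_diff (mot_ext_inl (N := unit) (dot_one m) y)) =
      mot_diff (ses_inj E (f y)).
    by rewrite -mot_diff_nat hinl !mot_diff_nat.
  have t3 : jmap hl (mot_diff x1) = mot_diff e.
    by rewrite mot_diff_iota linearN /= hinl em opprK.
  have -> : hl x = ses_inj E (f x.1) + (x.2 : S) *: e by [].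
  rewrite {1}xE !mot_diffD !mot_diffZ [LHS](raddfD (jmap hl)).
  congr (_ + _); first exact: t1.
  rewrite [LHS](raddfD (jmap hl)).
  congr (_ + _); rewrite [LHS](linearZZ (jmap hl)).
    by congr (_ *: _); exact: t2.
  by congr (_ *: _); exact: t3.
exists (@MHom B (mot_ext (N := unit) (dot_one m)) (ses_mid E) hl hlP).
split=> [y|[y s]]; rewrite /= /h /=; first by rewrite scale0r addr0.
rewrite linearD /= ses_surj_inj add0r linearZ /= en -linearZ.
by congr (g _); rewrite -[LHS]/((s : S) * 1) mulr1.
Qed.

Lemma ext1_equiv_cocycle N M (E E' : yext 1 N M) (n : N) m : mot_diff n = 0 ->
  yext_equiv E E' -> cocycle E n m <-> cocycle E' n m.
Proof.
move=> n0; elim=> {E E'} [E E' EE'|E|E E' _ IH|E E' E'' _ IH _ IH'] //.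
- split=> [/(cocycle_mor EE')|Em']; first by rewrite jmap_id.
  (* Morphisms transport cocycles only forwards. To go back, transport some cocycle of [E] to [E'],
     compare it with [m] there, and shift. *)
  have [m0 Em0] := cocycle_exists E n0.
  have := cocycle_mor EE' Em0; rewrite jmap_id // => /cocycle_unique/(_ Em')[x ->].
  exact: cocycle_shift.
- by rewrite IH.
- by rewrite IH.
Qed.

(** This removes zigzags: every extension in the class receives a single morphism from
    [ext_iota_ses m]. *)
Lemma ext_iotaE M (m : jinv M) (E : yext 1 unit M) :
  ext_iota m E <-> cocycle E (1 : unit) m.
Proof.
split=> [e|Em].
  by apply/(ext1_equiv_cocycle _ (mot_diff1 B) e); apply: cocycle_iota.
by apply: rst_step; apply: mor_cocycle; rewrite jmap_id.
Qed.
End Cocycle.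

(** * Ext^1 of the unit motive: the map iota *)

Section ExtOne.
Variable B : motive_base.
Local Notation S := (mb_S B).
Local Notation unit := (mot_unit B).
Implicit Types M N : motive B.

Lemma yclass_ext i N M (X Y : yclass i N M) : (forall E, X E <-> Y E) -> X = Y.
Proof. by move=> XY; apply/funext => E; apply/propext. Qed.

Lemma ext_class_eq i N M (E E' : yext i N M) :
  yext_equiv E E' -> ext_class E = ext_class E'.
Proof.
move=> e; apply: yclass_ext => E1; split; last exact: rst_trans.
by apply: rst_trans; apply: rst_sym.
Qed.

Lemma ext_iota_surj M (X : yclass 1 unit M) :
  Ext 1 unit M X <-> exists m, ext_iota m = X.
Proof.
split=> [[E ->]|[m <-]]; last by exists (ext_iota_ses m).
have [m Em] := cocycle_exists E (mot_diff1 B).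
by exists m; apply: ext_class_eq; apply/ext_iotaE.
Qed.

Lemma ext_iota_eq M (m m' : jinv M) :
  ext_iota m = ext_iota m' <-> exists x : M, m = m' + mot_diff x.
Proof.
split=> [e|[x ->]].
  have : ext_iota m (ext_iota_ses m') by rewrite e; apply: rst_refl.
  move=> /ext_iotaE /(cocycle_unique (cocycle_iota m')).
  by case=> x ->; exists x.
by apply: ext_class_eq; apply/ext_iotaE/cocycle_shift/cocycle_iota.
Qed.

Lemma ext_iota0 M : ext_iota (0 : jinv M) = ext_zero 1 unit M.
Proof.
rewrite /ext_zero /= /ext_iota /ext_iota_ses.
suff -> : dot_one (0 : jinv M) = \0 by [].
apply: linear_funext => x; apply: Defs.inv_inj.
have v0 : inv_val (0 : jinv M) = 0 by exact: (raddf0 val).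
by rewrite [RHS]v0 /= scaler0.
Qed.

Lemma ext_iota_ker M (m : jinv M) :
  ext_iota m = ext_zero 1 unit M <-> exists x, mot_diff x = m.
Proof.
rewrite -ext_iota0 ext_iota_eq.
by split=> -[x e]; exists x; move: e; rewrite add0r.
Qed.

Lemma ext_iota_push M M' (f : mhom M M') (m : jinv M) :
  ext_iota (jmap f m) = ext_push f (ext_iota m).
Proof.
apply: yclass_ext => E; rewrite ext_iotaE; split=> [Em|].
  exists (ext_iota_ses m), E; split; first exact: rst_refl.
    exact: mor_cocycle.
  exact: rst_refl.
move=> [E1 [E2 [/ext_iotaE E1m E12 E2E]]].
by apply/(ext1_equiv_cocycle _ (mot_diff1 B) E2E); apply: (cocycle_mor E12 E1m).
Qed.

Lemma ext_iotaZ M (a : mb_A B) (m : jinv_A M) :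
  ext_iota (a *: m) = ext_scale a (ext_iota m).
Proof.
rewrite /ext_scale -ext_iota_push; congr ext_iota.
rewrite (jmapZ (g := idfun : {linear M -> M}) (c := mb_in B a)) //.
by rewrite jmap_id.
Qed.

Lemma mot_sum_fstP M N x :
  jmap (@fstl B M N) (mot_tau (m := mot_sum M N) x) = mot_tau (tjmap fstl x).
Proof. by rewrite [LHS]mot_ext_tau_fst addr0. Qed.
Definition mot_sum_fst M N : mhom (mot_sum M N) M :=
  @MHom B (mot_sum M N) M fstl (@mot_sum_fstP M N).

Lemma cocycle_sum N M N' M' (E : ses N M) (E' : ses N' M') (n : N) (n' : N') m m' :
  cocycle E n m -> cocycle E' n' m' ->
  cocycle (ses_sum E E') ((n, n') : mot_sum N N') (jmap inll m + jmap inrl m').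
Proof.
move=> [e <- em] [e' <- em']; exists (e, e') => //.
pose ee : mot_sum (ses_mid E) (ses_mid E') := (e, e').
pose i : {linear (M * M')%type -> (ses_mid E * ses_mid E')%type} :=
  sum_mod (ses_inj E) (ses_inj E').
apply: (@jmap_pair_inj B (ses_mid E) (ses_mid E')).
- transitivity (jmap (ses_inj E) m).
    rewrite (jmap_comp (h := fstl) (g := i) (hg := ses_inj E \o fstl)) //.
    rewrite -(jmap_comp (h := ses_inj E) (g := fstl) (hg := ses_inj E \o fstl)) //.
    by rewrite linearD /= jmap_fst_inl jmap_fst_inr addr0.
  rewrite em [RHS](raddfN (jmap fstl)); congr (- _).
  exact: (esym (mot_diff_nat (mot_sum_fst _ _) ee)).
- transitivity (jmap (ses_inj E') m').
    rewrite (jmap_comp (h := sndl) (g := i) (hg := ses_inj E' \o sndl)) //.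
    rewrite -(jmap_comp (h := ses_inj E') (g := sndl) (hg := ses_inj E' \o sndl)) //.
    by rewrite linearD /= jmap_snd_inl jmap_snd_inr add0r.
  rewrite em' [RHS](raddfN (jmap sndl)); congr (- _).
  exact: (esym (mot_diff_nat (mot_ext_snd _) ee)).
Qed.

Lemma jmap_codiag M (m m' : jinv M) :
  jmap (mhom_codiag M) (jmap inll m + jmap inrl m') = m + m'.
Proof.
rewrite (jmapD (g := fstl) (h := sndl)) //.
rewrite !linearD /= jmap_fst_inl jmap_fst_inr jmap_snd_inl jmap_snd_inr.
by rewrite addr0 add0r.
Qed.

Lemma ext_iotaD M (m m' : jinv M) :
  ext_iota (m + m' : jinv_A M) = ext_add (ext_iota m) (ext_iota m').
Proof.
apply: yclass_ext => E; rewrite ext_iotaE.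
(* The extension given by [w] is a pullback of the direct sum along the diagonal, since the diagonal
   sends 1 to [(1, 1)]. *)
pose w : jinv (mot_sum M M) := jmap inll m + jmap inrl m'.
have codiag_w : jmap (mhom_codiag M) w = m + m' by exact: jmap_codiag.
split=> [Em|].
  exists (ext_iota_ses m), (ext_iota_ses m'), (ext_iota_ses w), E; split.
  - by split; apply: rst_refl.
  - apply: mor_cocycle; rewrite jmap_id //.
    by apply: cocycle_sum; apply: cocycle_iota.
  - by apply: mor_cocycle; rewrite codiag_w.
  - exact: rst_refl.
move=> [E1 [E2 [P [E3 [[/ext_iotaE E1m /ext_iotaE E2m] PE12 PE3 E3E]]]]].
apply/(ext1_equiv_cocycle _ (mot_diff1 B) E3E).
(* A cocycle [w'] of an arbitrary pullback [P] agrees with [w] up to some [mot_diff x]; after the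
   codiagonal this is a shift by its value at [x]. *)
have [w' Pw'] := cocycle_exists P (mot_diff1 B).
have := cocycle_mor PE12 Pw'; rewrite jmap_id // => Ew'.
have [x wE] := cocycle_unique Ew' (cocycle_sum E1m E2m).
have := cocycle_shift (mhom_codiag M x) (cocycle_mor PE3 Pw').
rewrite -mot_diff_nat -[X in cocycle _ _ X](raddfD (jmap (mhom_codiag M))).
by rewrite -wE => E3w; rewrite -codiag_w.
Qed.
End ExtOne.

(** * Vanishing of higher Ext, and Hom from the unit motive *)

Section ExtHigher.
Variable B : motive_base.
Local Notation S := (mb_S B).
Local Notation unit := (mot_unit B).
Implicit Types M N : motive B.

Lemma mhom_compP M N K (f : mhom M N) (g : mhom N K) (x : jinv (twist M)) :
  jmap (g \o f) (mot_tau x) = mot_tau (tjmap (g \o f) x).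
Proof.
rewrite -(jmap_comp (g := f) (h := g) (hg := g \o f)) // !mhomP.
by rewrite (tjmap_comp (hg := g \o f)).
Qed.
Definition mhom_comp M N K (f : mhom M N) (g : mhom N K) : mhom M K :=
  MHom (mhom_compP f g).

(** The pullback of [E] along [g] splits when [g] lifts to [p]: send [(m, x)] to the image of [m]
    plus [p x]. *)
Lemma ses_mor_split N' N M (g : mhom N' N) (E : ses N M) (p : mhom N' (ses_mid E)) :
  (forall x, ses_surj E (p x) = g x) ->
  ses_mor g (mhom_id M) (mot_ext_ses (\0 : {linear jinv (twist N') -> jinv M})) E.
Proof.
move=> pg; exists (mhom_comp (mhom_sum (ses_inj E) p) (mhom_codiag (ses_mid E))).
split=> [m|[m x]]; rewrite /= /codiag_mod /=; first by rewrite linear0 addr0.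
by rewrite linearD /= ses_surj_inj add0r pg.
Qed.

Lemma ses_mor_id N M (E : ses N M) : ses_mor (mhom_id N) (mhom_id M) E E.
Proof. by exists (mhom_id (ses_mid E)). Qed.

Lemma yseq_mor_id n N M (X : yseq n N M) : yseq_mor (mhom_id N) (mhom_id M) X X.
Proof.
elim: n N X => [|n IH] N X; first exact: ses_mor_id.
by exists (mhom_id (projT1 X)); split; [exact: ses_mor_id|exact: IH].
Qed.

Lemma yseq_zero_mor n N M (X : yseq n N M) :
  yseq_mor (0 : mhom (mot_zero B) N) (mhom_id M) (yseq_zero n (mot_zero B) M) X.
Proof.
elim: n N X => [|n IH] N X.
  by apply: (ses_mor_split (p := 0)) => x; rewrite linear0.
exists 0; split; last exact: IH.
exists 0; split=> [m|e]; first by rewrite [RHS]linear0.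
by rewrite linear0.
Qed.

(* p is the surjection of the short exact sequence of X that ends in N.  Its
   pullback along p is split, hence also a pullback of a sequence ending in 0. *)
Lemma yseq_split_cover n N M (X : yseq n N M) :
  exists (E : motive B) (p : mhom E N) (Y : yseq n E M) (Z : yseq n (mot_zero B) M),
    [/\ forall y : jinv N, exists x, jmap p x = y,
        yseq_mor p (mhom_id M) Y X
      & yseq_mor (0 : mhom E (mot_zero B)) (mhom_id M) Y Z].
Proof.
case: n X => [X|n [K [X1 X2]]].
  exists (ses_mid X), (ses_surj X), (yseq_zero 0 _ M), (yseq_zero 0 _ M).
  split; first exact: jmap_ses_surj.
    exact: (ses_mor_split (p := mhom_id _)).
  by apply: (ses_mor_split (p := 0)).
(* In a longer sequence only the first short exact sequence is replaced by a split one; the tail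
   [X2] stays. *)
exists (ses_mid X1), (ses_surj X1).
exists (existT _ K (yseq_zero 0 _ K, X2)), (existT _ K (yseq_zero 0 _ K, X2)).
split; first exact: jmap_ses_surj.
  exists (mhom_id K); split; last exact: yseq_mor_id.
  exact: (ses_mor_split (p := mhom_id _)).
exists (mhom_id K); split; last exact: yseq_mor_id.
by apply: (ses_mor_split (p := 0)).
Qed.

(** The equivalence is the zigzag of morphisms from [Y'] to the given extension, from [Y'] to [Z'],
    and from the zero extension to [Z']. *)
Lemma ext_higher_zero M i (X : yclass i unit M) :
  (2 <= i)%N -> Ext i unit M X -> X = ext_zero i unit M.
Proof.
case: i X => [|[|n]] // X _ [[K [X1 X2]] ->]; apply: ext_class_eq.
have [E [p [Y [Z [p_surj YX YZ]]]]] := yseq_split_cover X2.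
have [w X1w] := cocycle_exists X1 (mot_diff1 B).
have [w' w'w] := p_surj w.
pose Y' : yext n.+2 unit M := existT _ E (ext_iota_ses w', Y).
pose Z' : yext n.+2 unit M := existT _ (mot_zero B) (ses_id unit, Z).
apply: (@rst_trans _ _ _ Y').
  apply: rst_sym; apply: rst_step; exists p; split=> //.
  by apply: mor_cocycle; rewrite w'w.
apply: (@rst_trans _ _ _ Z').
  apply: rst_step; exists 0; split=> //.
  (* Over the zero map from [E] to the zero motive, the middle term projects onto the unit
     motive. *)
  exists (ses_surj (ext_iota_ses w' : ses _ _)); split=> // m.
apply: rst_sym; apply: rst_step; exists 0; split; last exact: yseq_zero_mor.
by exists (mhom_id unit); split.
Qed.

Lemma hom_ev_inj M : injective (@hom_ev B M).
Proof.
move=> f g e; apply: mhom_ext => s.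
by rewrite -[s]mulr1 -[s * 1]/(s *: (1 : S^o)) !linearZ /= [f _]e.
Qed.

(** For [x] fixed by tau, [s |-> s x] is a morphism: by the Leibniz rule, id - tau multiplies both 1
    and [x] by [s - tau s] when applied to their multiples by [s]. *)
Lemma hom_ev_ker M (x : M) :
  mot_diff x = 0 <-> exists f : mhom unit M, hom_ev f = x.
Proof.
split=> [x0|[f <-]]; last by rewrite -mot_diff_nat mot_diff1 linear0.
pose h (s : unit) : M := (s : S) *: x.
have h_lin : linear h by move=> a s t; rewrite /h scalerDl -scalerA.
pose hl : {linear unit -> M} := HB.pack h (GRing.isLinear.Build S _ _ _ h h_lin).
have hlP : forall y, jmap hl (mot_tau y) = mot_tau (tjmap hl y).
  apply: mot_diff_homP => s.
  rewrite -[hl s]/((s : S) *: x) mot_diffZ x0 scaler0 addr0.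
  rewrite -[s in LHS]mulr1 -[s * 1]/(s *: (1 : S^o)) (mot_diffZ (M := unit)).
  rewrite mot_diff1 scaler0 addr0.
  rewrite [LHS](linearZZ (jmap hl)) jmap_in; congr (_ *: jin _).
  by rewrite /= /h scale1r.
by exists (@MHom B unit M hl hlP); rewrite /hom_ev /= /h scale1r.
Qed.
End ExtHigher.

Theorem theorem2p13 (F : finFieldType) (C : curve F) (infty : closed_point C)
  (R : comPzRingType) (iR : {rmorphism F -> R})
  (kappa : {rmorphism affine_ring infty -> R})
  (kappa_F : forall c : F, kappa (affine_const infty c) = iR c)
  (R_noetherian : noetherian R)
  (M : amotive iR kappa) :
  let B := amot_base iR kappa in
  let unit := mot_unit B in
  [/\ (* Hom(1, M) = ker (id - tau_M), through f |-> f 1 *)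
      injective (@hom_ev B M) /\
      (forall x, mot_diff x = 0 <-> exists f : mhom unit M, hom_ev f = x),
      (* Ext^i(1, M) = 0 for i >= 2 *)
      forall i, (2 <= i)%N ->
        forall X, Ext i unit M X -> X = ext_zero i unit M
    & (* ext_iota : M[j^-1] -> Ext^1(1, M) *)
      [/\ (* surjective *)
          forall X, Ext 1 unit M X <-> exists m, ext_iota m = X,
          (* A-linear *)
          (forall m m' : jinv_A M, ext_iota (m + m') = ext_add (ext_iota m) (ext_iota m')) /\
          (forall (a : mb_A B) (m : jinv_A M),
             ext_iota (a *: m) = ext_scale a (ext_iota m)),
          (* with kernel (id - tau_M)(M) *)
          forall m, ext_iota m = ext_zero 1 unit M <-> exists x, mot_diff x = m
        & (* natural in M *)
          forall (M' : amotive iR kappa) (f : mhom M M') (m : jinv M),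
            ext_iota (jmap f m) = ext_push f (ext_iota m)]].
Proof.
move=> B unit; split.
- by split; [apply: hom_ev_inj|apply: hom_ev_ker].
- by move=> i i2 X; apply: ext_higher_zero.
- split.
  + exact: ext_iota_surj.
  + by split; [apply: ext_iotaD|apply: ext_iotaZ].
  + exact: ext_iota_ker.
  + exact: ext_iota_push.
Qed.
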